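(* Let $X$ be a Banach space, $\omega\ge0$, $v:\mathbb{R}\to[1,\infty)$ strongly admissible, and let $A$ be an operator on $X$ with a bounded $\mathrm{W}^2_v(S_\omega)$-calculus $\Psi$. Suppose that $f\in\mathrm{H\ddot{o}r}^2_v(S_\omega)$ and that $(f_n)_n$ is a sequence in $\mathrm{H\ddot{o}r}^2_v(S_\omega)$ such that \begin{enumerate} \item there is an ample set $\mathcal D\subseteq\mathrm{H}^\infty_0[\overline{S_\omega}]$ with $\|\psi(f_n-f)\|_{\mathrm{W}^2_v(S_\omega)}\to0$ as $n\to\infty$ for all $\psi\in\mathcal D$; \item each $f_n(A)$ is bounded and $\sup_{n\in\mathbb{N}}\|f_n(A)\|<\infty$. \end{enumerate} Then $f(A)\in\mathcal L(X)$ and $f_n(A)\to f(A)$ strongly on $X$.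
   Context: $S_\omega=\{|\operatorname{Im}z|<\omega\}$ ($S_0=\mathbb{R}$); $\tau_tf=f(\cdot-t)$; $\hat g(t)=\int g(s)e^{-\mathrm{i}st}ds$. A measurable $v:\mathbb{R}\to(0,\infty)$ is admissible if $v\ge1$ and $\sup_{s,t}\frac{v(s+t)}{v(s)+v(t)}<\infty$, strongly admissible if also $1/v\in L^2(\mathbb{R})$. $\mathrm{W}^2_v(S_\omega)=\{\hat g:ve^{\omega|\cdot|}g\in L^2\}$, norm $\|ve^{\omega|\cdot|}g\|_2$ (a Banach algebra of functions on $S_\omega$ for strongly admissible $v$). With $G(z)=e^{-z^2}$, $\mathrm{H\ddot{o}r}^2_v(S_\omega)$ consists of functions $f$ on $S_\omega$ with $\sup_t\|\tau_tG\cdot f\|_{\mathrm{W}^2_v(S_\omega)}<\infty$; for such $f$ one has $Gf\in\mathrm{W}^2_v(S_\omega)$. $\mathrm{H}^\infty_0(S_\theta)$: holomorphic $f$ on $S_\theta$ with $|f(z)|\lesssim(1+|\operatorname{Re}z|)^{-\alpha}$ for all $\alpha>0$; $\mathrm{H}^\infty_0[\overline{S_\omega}]=\bigcup_{\theta>\omega}\mathrm{H}^\infty_0(S_\theta)$. $A$ has a bounded $\mathrm{W}^2_v(S_\omega)$-calculus if there is a bounded algebra homomorphism $\Psi:\mathrm{W}^2_v(S_\omega)\to\mathcal L(X)$ with $\Psi((\lambda-z)^{-1})=R(\lambda,A)$ for $\lambda\notin\overline{S_\omega}$; then $A$ is of strip type $\omega$ and $\psi(A):=\Psi(\psi)$ for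 $\psi\in\mathrm{W}^2_v(S_\omega)$ (this agrees with the holomorphic calculus). For $f\in\mathrm{H\ddot{o}r}^2_v(S_\omega)$, $f(A)$ is the closed operator $\Psi(G)^{-1}\Psi(Gf)$ ($\Psi(G)$ is injective). A set $\mathcal D$ of such functions is ample if the closed linear span of $\bigcup_{\psi\in\mathcal D}\operatorname{ran}\psi(A)$ is $X$. *)

(* Defs.v *)
From HB Require Import structures.
From mathcomp Require Import all_boot all_order all_algebra.
From mathcomp Require Import all_classical all_reals all_analysis.
From mathcomp Require Import complex.
Import Order.TTheory GRing.Theory Num.Theory.
Import numFieldNormedType.Exports.

Set Implicit Arguments.
Unset Strict Implicit.
Unset Printing Implicit Defensive.

Local Open Scope ring_scope.
Local Open Scope classical_set_scope.

Section StripCalculus.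
Context {R : realType}.
Local Notation C := (R[i]).

Definition rC (x : R) : C := Complex x 0.

Definition reC (z : C) : R := complex.Re z.
Definition imC (z : C) : R := complex.Im z.

Definition cabs (z : C) : R := Num.sqrt (reC z ^+ 2 + imC z ^+ 2).

Definition cexp (z : C) : C :=
  Complex (expR (reC z) * cos (imC z)) (expR (reC z) * sin (imC z)).

Definition strip (w : R) : set C :=
  if w == 0 then [set z | imC z = 0] else [set z | `|imC z| < w].

Definition cstrip (w : R) : set C := [set z | `|imC z| <= w].

Definition cmeasurable (g : R -> C) : Prop :=
  measurable_fun setT (fun s => reC (g s)) /\
  measurable_fun setT (fun s => imC (g s)).

Definition cintegral (h : R -> C) : C :=
  Complex (Rintegral lebesgue_measure setT (fun s => reC (h s)))
          (Rintegral lebesgue_measure setT (fun s => imC (h s))).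

Definition fourier (g : R -> C) (z : C) : C :=
  cintegral (fun s => g s * cexp (- ('i * (rC s * z)))).

Definition wL2norm (v : R -> R) (w : R) (g : R -> C) : \bar R :=
  Lnorm lebesgue_measure 2%:E
    (fun s => (v s * expR (w * `|s|) * cabs (g s))%:E).

Definition Wrep (v : R -> R) (w : R) (F : C -> C) (g : R -> C) : Prop :=
  [/\ cmeasurable g, (wL2norm v w g < +oo)%E &
      forall z, strip w z -> F z = fourier g z].

Definition inW (v : R -> R) (w : R) (F : C -> C) : Prop := exists g, Wrep v w F g.

(* norm in W^2_v(S_w) (all representatives have the same norm);
   it is +oo when F is not in W^2_v(S_w) *)
Definition Wnorm (v : R -> R) (w : R) (F : C -> C) : \bar R :=
  ereal_inf [set wL2norm v w g | g in Wrep v w F].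

Definition admissible (v : R -> R) : Prop :=
  [/\ measurable_fun setT v, (forall s, 1 <= v s) &
      exists c : R, forall s t, v (s + t) <= c * (v s + v t)].

Definition strongly_admissible (v : R -> R) : Prop :=
  admissible v /\
  (Lnorm lebesgue_measure 2%:E (fun s => ((v s)^-1)%:E) < +oo)%E.

Definition gauss (z : C) : C := cexp (- z ^+ 2).

Definition inHor (v : R -> R) (w : R) (f : C -> C) : Prop :=
  exists c : R, forall t : R,
    (Wnorm v w (fun z => (gauss (z - rC t) * f z)%R) <= c%:E)%E.

Definition inH0 (th : R) (f : C -> C) : Prop :=
  (forall z, strip th z -> derivable (f : C^o -> C^o) z 1) /\
  (forall a : R, 0 < a -> exists c : R, forall z, strip th z ->
      cabs (f z) <= c * (1 + `|reC z|) `^ (- a)).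

Definition inH0closed (w : R) (f : C -> C) : Prop :=
  exists th, w < th /\ inH0 th f.

Context {X : completeNormedModType C}.

Definition bounded_op (T : X -> X) : Prop :=
  linear T /\ exists M : R, forall x, `|T x| <= rC M * `|x|.

Definition is_operator (D : set X) (A : X -> X) : Prop :=
  D 0 /\ (forall a x y, D x -> D y -> D (a *: x + y)) /\
  (forall a x y, D x -> D y -> A (a *: x + y) = a *: A x + A y).

Definition Wcalculus (v : R -> R) (w : R) (D : set X) (A : X -> X)
    (Psi : (C -> C) -> X -> X) : Prop :=
  [/\ forall F, inW v w F -> bounded_op (Psi F),
      forall F G, inW v w F -> inW v w G ->
        Psi (fun z => F z + G z) = (fun x => Psi F x + Psi G x),
      forall (a : C) F, inW v w F ->
        Psi (fun z => a * F z) = (fun x => a *: Psi F x),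
      forall F G, inW v w F -> inW v w G ->
        Psi (fun z => F z * G z) = (fun x => Psi F (Psi G x)) &
      exists M : R, forall F, inW v w F -> forall x,
        `|Psi F x| <= rC (M * fine (Wnorm v w F)) * `|x|] /\
  (forall lam : C, ~ cstrip w lam ->
        let r := Psi (fun z => (lam - z)^-1) in
        (forall y, D (r y) /\ lam *: r y - A (r y) = y) /\
        (forall x, D x -> r (lam *: x - A x) = x)).

(* the graph of the closed operator f(A) = Psi(G)^{-1} Psi(G f):
   fcalc Psi f x y  <->  x in dom f(A) and f(A) x = y *)
Definition fcalc (Psi : (C -> C) -> X -> X) (f : C -> C) (x y : X) : Prop :=
  Psi gauss y = Psi (fun z => gauss z * f z) x.

Definition fcalc_is (Psi : (C -> C) -> X -> X) (f : C -> C) (T : X -> X) : Prop :=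
  bounded_op T /\ forall x y, fcalc Psi f x y <-> y = T x.

Definition ample (Psi : (C -> C) -> X -> X) (Dset : set (C -> C)) : Prop :=
  closure [set x | exists (n : nat) (a : 'I_n -> C) (ps : 'I_n -> C -> C)
                          (ys : 'I_n -> X),
             (forall i, Dset (ps i)) /\
             x = \sum_(i < n) a i *: Psi (ps i) (ys i)] = setT.

End StripCalculus.

(* Main.v *)
Require Import Defs.
From HB Require Import structures.
From mathcomp Require Import all_boot all_order all_algebra.
From mathcomp Require Import all_classical all_reals all_analysis measurable_realfun.
From mathcomp Require Import complex ring lra.
Import Order.TTheory GRing.Theory Num.Theory.
Import numFieldNormedType.Exports.
Set Implicit Arguments.
Unset Strict Implicit.
Unset Printing Implicit Defensive.

Local Open Scope ring_scope.
Local Open Scope classical_set_scope.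

(** Since Psi(G) is injective, on the range of psi(A) the difference f_n(A) - f(A)
    is the bounded operator Psi(psi (f_n - f)), which tends to 0; ampleness and the
    uniform bound on f_n(A) then give strong convergence everywhere, and applying
    Psi(G) identifies the limit with f(A).

    This needs psi and the Gaussian to belong to W, that is, H^oo_0 of a larger
    strip is contained in W.  The Cauchy theorem (Goursat's bisection) lets one shift
    the line of integration in the Fourier integral g of psi, so that
    |g(s)| <= C exp(-beta |s|) with beta > w; Abel summation (a Poisson kernel) inverts
    the Fourier integral on every line of the strip; and an admissible weight grows
    more slowly than any exponential, because it is bounded near 0. *)

(** Complex integrals and derivatives are handled through real and imaginary parts, so Cauchy's
    theorem takes the form: a closed real form [P dx + Q dy] has circulation zero around rectangles.
    A function in [inH0] comes with complex differentiability at each point and no continuity of the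
    derivative, which is why bisection takes the place of Green's formula. The line
    [beta = (w + th) / 2] leaves a margin [beta - w] on each side: half of it absorbs the weight
    [v], the other half keeps the Fourier density square integrable. Injectivity of [Psi gauss] is
    drawn from the second hypothesis: the graph of [f_0(A)] is single-valued. On the range of
    [psi(A)] the value of [f(A)] cannot be written as [Psi (psi f)], because [psi f] is not known to
    lie in W; it is expressed through one index [N] for which [psi (f_N - f)] does lie in W. *)

(** * Change of variables for integrals on the line *)

Lemma ge0_integral_scaled_measure d (T : measurableType d) (R : realType)
    (m1 m2 : {measure set T -> \bar R}) (k : {nonneg R}) (f : T -> \bar R) :
  measurable_fun setT f -> (forall x, 0 <= f x)%E ->
  (forall A, measurable A -> m1 A = k%:num%:E * m2 A)%E ->
  (\int[m1]_x f x = k%:num%:E * \int[m2]_x f x)%E.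
Proof.
move=> mf f0 m12; rewrite -ge0_integral_mscale//.
by apply: eq_measure_integral => A mA _; rewrite m12.
Qed.

Lemma ge0_integral_pushforward_measure d d' (S : measurableType d)
    (T : measurableType d') (R : realType) (m : {measure set S -> \bar R})
    (phi : S -> T) (f : T -> \bar R) :
  measurable_fun setT f -> (forall x, 0 <= f x)%E -> measurable_fun setT phi ->
  exists2 n : {measure set T -> \bar R}, (forall A, n A = m (phi @^-1` A)) &
    (\int[m]_x f (phi x) = \int[n]_x f x)%E.
Proof.
move=> mf f0 mphi.
have E := @ge0_integral_pushforward _ _ _ _ _ _ mphi m setT f measurableT mf (fun x _ => f0 x).
rewrite preimage_setT in E.
pose n : {measure set T -> \bar R} := pushforward m phi.
by exists (n mphi) => //; rewrite E.
Qed.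

(** Finiteness plays no part: multiplication by [c > 0] preserves infinite values, and [fine] sends
    those to 0 on both sides. Substitution in [Rintegral] then holds for every measurable
    function. *)
Lemma fine_muleBr (R : realType) (c : R) (p n : \bar R) : 0 < c ->
  fine (c%:E * p - c%:E * n) = c * fine (p - n).
Proof.
move=> c0; case: p => [p| |]; case: n => [n| |] //=;
  rewrite ?gt0_muley ?gt0_muleNy ?lte_fin//= ?mulr0// ?mulrBr//.
Qed.

Lemma Rintegral_ge0_substitution d (T : measurableType d) (R : realType)
    (m : {measure set T -> \bar R}) (phi : T -> T) (c : R) : 0 < c ->
  (forall h : T -> \bar R, measurable_fun setT h -> (forall x, 0 <= h x)%E ->
     \int[m]_x h x = c%:E * \int[m]_x h (phi x))%E ->
  forall f : T -> R, measurable_fun setT f ->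
  \int[m]_x f x = c * \int[m]_x f (phi x).
Proof.
move=> c0 H f mf; rewrite /Rintegral.
have mE : measurable_fun setT (EFin \o f) by exact/measurable_EFinP.
have Ep := H _ (measurable_funepos mE) (funepos_ge0 _).
have En := H _ (measurable_funeneg mE) (funeneg_ge0 _).
rewrite integralE (integralE m setT (fun x => (f (phi x))%:E)).
rewrite [X in fine (X - _)]Ep [X in fine (_ - X)]En fine_muleBr//.
rewrite -[fun x => (f (phi x))%:E]/((EFin \o f) \o phi).
by rewrite (funepos_comp (EFin \o f) phi) (funeneg_comp (EFin \o f) phi).
Qed.

Section AffineSubstitution.
Context {R : realType}.
Local Notation mu := (@lebesgue_measure R).
Implicit Types (f : R -> R) (c d : R).

Lemma measurable_affine c d :
  measurable_fun setT ((fun x => c * x + d) : measurableTypeR R -> measurableTypeR R).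
Proof.
apply: continuous_measurable_fun => x.
by apply: cvgD; [apply: cvgM; [exact: cvg_cst|exact: cvg_id]|exact: cvg_cst].
Qed.

(** By uniqueness of Lebesgue measure: the scaled pushforward agrees with it on half-open
    intervals. *)
Lemma lebesgue_measure_affine c d (A : set (measurableTypeR R)) : 0 < c -> measurable A ->
  mu A = (c%:E * mu ((fun x => (c * x + d)%R) @^-1` A))%E.
Proof.
move=> c0 mA; pose phi := (fun x => c * x + d) : measurableTypeR R -> measurableTypeR R.
have mphi : measurable_fun setT phi := measurable_affine c d.
have cge0 := ltW c0.
pose nu : {measure set (measurableTypeR R) -> \bar R} :=
  mscale (NngNum cge0) (pushforward mu phi).
rewrite (@lebesgue_measure_unique R (nu mphi))//.
move=> _ [[a b]] _ <-.
rewrite -[RHS]/(c%:E * mu (phi @^-1` `]a, b]))%E.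
rewrite (_ : phi @^-1` _ = `](a - d) / c, (b - d) / c]%classic); last first.
  apply/seteqP; split => x; rewrite /phi /= !in_itv/= ltr_pdivrMr// ler_pdivlMr//;
  by rewrite ltrBlDr lerBrDr mulrC.
rewrite !lebesgue_measure_itv/= !lte_fin ltr_pM2r ?invr_gt0// ltrD2r.
case: ifPn => _; last by rewrite mule0.
rewrite -!EFinB -EFinM; congr EFin; rewrite -mulrBl mulrCA divff ?gt_eqF// mulr1.
by lra.
Qed.

Lemma ge0_integral_affine c d (f : measurableTypeR R -> \bar R) : 0 < c ->
  measurable_fun setT f -> (forall x, 0 <= f x)%E ->
  (\int[mu]_x f x = c%:E * \int[mu]_x f (c * x + d)%R)%E.
Proof.
move=> c0 mf f0.
have [nu nuA ->] := ge0_integral_pushforward_measure mu mf f0 (@measurable_affine c d).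
apply: (ge0_integral_scaled_measure (k := NngNum (ltW c0)) mf f0) => A mA.
transitivity (mu A) => //; rewrite (lebesgue_measure_affine d c0 mA) /= -[mu (_ @^-1` A)]nuA.
by [].
Qed.

Lemma Rintegral_affine c d (f : measurableTypeR R -> R) : 0 < c ->
  measurable_fun setT f -> \int[mu]_x f x = c * \int[mu]_x f (c * x + d).
Proof.
move=> c0 mf.
apply: (Rintegral_ge0_substitution (m := mu) (phi := fun x => c * x + d) c0 _ mf).
by move=> h mh h0; exact: ge0_integral_affine.
Qed.

Lemma ge0_integralN (f : measurableTypeR R -> \bar R) :
  measurable_fun setT f -> (forall x, 0 <= f x)%E ->
  (\int[mu]_x f x = \int[mu]_x f (- x)%R)%E.
Proof.
move=> mf f0.
have mN : measurable_fun setT (-%R : measurableTypeR R -> measurableTypeR R).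
  exact: oppr_measurable.
have [nu nuA ->] := ge0_integral_pushforward_measure mu mf f0 mN.
apply: eq_measure_integral => A mA _.
rewrite nuA; have := lebesgue_measureN mA; move=> h; exact: (esym h).
Qed.

Lemma RintegralN (f : measurableTypeR R -> R) :
  measurable_fun setT f -> \int[mu]_x f x = \int[mu]_x f (- x).
Proof.
move=> mf; rewrite -[RHS]mul1r.
apply: (Rintegral_ge0_substitution (m := mu) (phi := -%R) ltr01 _ mf).
by move=> h mh h0; rewrite mul1e; exact: ge0_integralN.
Qed.

End AffineSubstitution.

(** * Integrals of continuous functions over segments *)

Section IntervalIntegral.
Context {R : realType}.
Local Notation mu := (@lebesgue_measure R).
Implicit Types (f : R -> R) (a b m k e : R).

Definition itvint f a b : R := \int[mu]_(x in `[a, b]) f x.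

(** Two-sided continuity is demanded at the endpoints too, so that restriction to a subsegment is
    immediate. *)
Definition cont_on f a b := forall x, a <= x <= b -> {for x, continuous f}.

Lemma cont_onW f a b a' b' : a <= a' -> b' <= b -> cont_on f a b -> cont_on f a' b'.
Proof.
by move=> aa bb cf x /andP[ax xb]; apply: cf; rewrite (le_trans aa)//= (le_trans xb).
Qed.

Lemma cont_on_integrable f a b : cont_on f a b ->
  mu.-integrable `[a, b] (EFin \o f).
Proof.
move=> cf; apply: continuous_compact_integrable; first exact: segment_compact.
apply: continuous_in_subspaceT => x; rewrite inE/= in_itv/= => axb.
exact: cf.
Qed.

Lemma itvintD f a m b : a <= m <= b -> cont_on f a b ->
  itvint f a b = itvint f a m + itvint f m b.
Proof.
move=> /andP[am mb] cf; apply/eqP; rewrite addrC -subr_eq; apply/eqP.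
rewrite /itvint Rintegral_itvB ?bnd_simp//; last exact: cont_on_integrable.
rewrite Rintegral_itv_obnd_cbnd//.
apply: (integrableS _ _ _ (cont_on_integrable (cont_onW am (lexx b) cf))) => //.
by move=> x /=; rewrite !in_itv/= => /andP[/ltW -> ->].
Qed.

Lemma itvint_approx f a b k e : a <= b -> cont_on f a b ->
  (forall x, a <= x <= b -> `|f x - k| <= e) ->
  `|itvint f a b - k * (b - a)| <= e * (b - a).
Proof.
move=> ab cf fk.
have Ecst c : itvint (cst c) a b = c * (b - a).
  rewrite /itvint Rintegral_cst//= lebesgue_measure_itv/= lte_fin.
  by move: ab; rewrite le_eqVlt => /orP[/eqP ->|->] //; rewrite ltxx subrr mulr0.
have icst c : mu.-integrable `[a, b] (EFin \o cst c).
  by apply: cont_on_integrable => x _; exact: cst_continuous.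
have If := cont_on_integrable cf.
rewrite -(Ecst k) -(Ecst e) /itvint -RintegralB//.
have Ifk : mu.-integrable `[a, b] (EFin \o (fun x => f x - k)).
  by apply: cont_on_integrable => x xab; apply: cvgB; [exact: cf|exact: cvg_cst].
apply: (le_trans (le_normr_Rintegral _ Ifk)) => //.
apply: le_Rintegral => //.
exact: (integrable_norm Ifk).
Qed.

End IntervalIntegral.

(** * Bisection for additive rectangle functions *)

Section Bisection.
Context {R : realType}.
Variables (J : R -> R -> R -> R -> R) (a b c d : R).
Hypotheses (ab : a <= b) (cd : c <= d).
Hypothesis J_splitx : forall a' m b' c' d', a <= a' -> a' <= m -> m <= b' -> b' <= b ->
  c <= c' -> c' <= d' -> d' <= d -> J a' b' c' d' = J a' m c' d' + J m b' c' d'.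
Hypothesis J_splity : forall a' b' c' m d', a <= a' -> a' <= b' -> b' <= b ->
  c <= c' -> c' <= m -> m <= d' -> d' <= d -> J a' b' c' d' = J a' b' c' m + J a' b' m d'.
Hypothesis J_local : forall x y, a <= x <= b -> c <= y <= d -> forall e, 0 < e ->
  exists2 delta, 0 < delta & forall a' b' c' d',
    [/\ a <= a', a' <= x, x <= b' & b' <= b] ->
    [/\ c <= c', c' <= y, y <= d' & d' <= d] ->
    b' - a' < delta -> d' - c' < delta ->
    `|J a' b' c' d'| <= e * (b' - a' + (d' - c')) ^+ 2.

Let valid (r : (R * R) * (R * R)) :=
  [/\ a <= r.1.1, r.1.1 <= r.1.2 & r.1.2 <= b] /\
  [/\ c <= r.2.1, r.2.1 <= r.2.2 & r.2.2 <= d].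
Let Jr (r : (R * R) * (R * R)) := J r.1.1 r.1.2 r.2.1 r.2.2.

Let sub_half (r s : (R * R) * (R * R)) := valid s /\
  [/\ r.1.1 <= s.1.1, s.1.2 <= r.1.2, r.2.1 <= s.2.1 & s.2.2 <= r.2.2] /\
  [/\ s.1.2 - s.1.1 = (r.1.2 - r.1.1) / 2, s.2.2 - s.2.1 = (r.2.2 - r.2.1) / 2
    & `|Jr r| <= 4 * `|Jr s|].

(** If each of the four quarters carried less than a quarter of [|J|], the triangle inequality would
    fail. *)
Let bisect_step (r : (R * R) * (R * R)) : valid r -> exists s, sub_half r s.
Proof.
case: r => [[p q] [u v]] [[/= ap pq qb] [/= cu uv vd]].
set m := (p + q) / 2; set n := (u + v) / 2.
have pm : p <= m by rewrite /m; lra.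
have mq : m <= q by rewrite /m; lra.
have un : u <= n by rewrite /n; lra.
have nv : n <= v by rewrite /n; lra.
have am := le_trans ap pm; have mb := le_trans mq qb.
have cn := le_trans cu un; have nd := le_trans nv vd.
have EJ : J p q u v = (J p m u n + J p m n v) + (J m q u n + J m q n v).
  by rewrite (J_splitx ap pm mq qb cu uv vd) !(J_splity _ _ _ cu un nv vd).
have := @ler_normD R _ (J p m u n + J p m n v) (J m q u n + J m q n v); rewrite -EJ => H1.
have H2 := ler_normD (J p m u n) (J p m n v).
have H3 := ler_normD (J m q u n) (J m q n v).
have [h1|h1] := leP `|J p q u v| (4 * `|J p m u n|).
  by exists ((p, m), (u, n)); do !split => //=; rewrite /m /n; lra.
have [h2|h2] := leP `|J p q u v| (4 * `|J p m n v|).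
  by exists ((p, m), (n, v)); do !split => //=; rewrite /m /n; lra.
have [h3|h3] := leP `|J p q u v| (4 * `|J m q u n|).
  by exists ((m, q), (u, n)); do !split => //=; rewrite /m /n; lra.
have [h4|h4] := leP `|J p q u v| (4 * `|J m q n v|).
  by exists ((m, q), (n, v)); do !split => //=; rewrite /m /n; lra.
by exfalso; lra.
Qed.

Let nested_point (l u : nat -> R) (lo hi : R) :
  (forall n, lo <= l n) -> (forall n, u n <= hi) -> (forall n, l n <= u n) ->
  (forall n, l n <= l n.+1) -> (forall n, u n.+1 <= u n) ->
  exists2 x, lo <= x <= hi & forall n, l n <= x <= u n.
Proof.
move=> lol uhi lu ndl niu.
have hl : {homo l : m n / (m <= n)%N >-> m <= n} by apply: homo_leq => // ? ? ?; exact: le_trans.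
have hu : {homo u : m n / (m <= n)%N >-> m >= n}.
  by apply: homo_leq => // y x z xy yz; exact: le_trans yz xy.
have lun m n : l m <= u n.
  apply: (le_trans (hl _ _ (leq_maxl m n))); apply: (le_trans (lu _)).
  exact: hu (leq_maxr m n).
have bnd : forall n, ubound (range l) (u n) by move=> n _ [m _ <-].
have hs : has_sup (range l) by split; [exists (l 0%N), 0%N|exists (u 0%N); exact: bnd].
have lx n : l n <= sup (range l) by apply: ub_le_sup; [case: hs|exists n].
have xu n : sup (range l) <= u n by apply: ge_sup; [case: hs|exact: bnd].
exists (sup (range l)); last by move=> n; rewrite lx xu.
by rewrite (le_trans (lol 0%N))//= (le_trans (xu 0%N)).
Qed.

(** Quartering yields nested rectangles with [|J a b c d| <= 4 ^ n |J r_n|], shrinking to a point.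
    There [J_local] bounds [|J r_n|] by a small multiple of the squared size, which is of order
    [4 ^ (- n)], so the two powers cancel. *)
Lemma bisection_eq0 : J a b c d = 0.
Proof.
have /choice[step stepP] : forall r, exists s, valid r -> sub_half r s.
  move=> r; have [vr|nvr] := pselect (valid r); last by exists r.
  by have [s hs] := bisect_step vr; exists s.
pose r n := iter n step ((a, b), (c, d)).
have vr n : valid (r n).
  elim: n => [|n IH]; first by do !split => //=.
  by have [] := stepP _ IH.
have sr n : sub_half (r n) (r n.+1) := stepP _ (vr n).
have [x xab xr] : exists2 x, a <= x <= b & forall n, (r n).1.1 <= x <= (r n).1.2.
  apply: (nested_point (l := fun n => (r n).1.1) (u := fun n => (r n).1.2)) => n.
  - by have [[]] := vr n.
  - by have [[]] := vr n.
  - by have [[]] := vr n.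
  - by have [_ [[]]] := sr n.
  - by have [_ [[]]] := sr n.
have [y ycd yr] : exists2 y, c <= y <= d & forall n, (r n).2.1 <= y <= (r n).2.2.
  apply: (nested_point (l := fun n => (r n).2.1) (u := fun n => (r n).2.2)) => n.
  - by have [_ []] := vr n.
  - by have [_ []] := vr n.
  - by have [_ []] := vr n.
  - by have [_ [[]]] := sr n.
  - by have [_ [[]]] := sr n.
have w1 n : (r n).1.2 - (r n).1.1 = (b - a) / 2 ^+ n.
  elim: n => [|n IH]; first by rewrite expr0 divr1.
  by have [_ [_ [-> _ _]]] := sr n; rewrite IH exprSr invfM mulrA.
have w2 n : (r n).2.2 - (r n).2.1 = (d - c) / 2 ^+ n.
  elim: n => [|n IH]; first by rewrite expr0 divr1.
  by have [_ [_ [_ -> _]]] := sr n; rewrite IH exprSr invfM mulrA.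
have Jn n : `|J a b c d| <= 4 ^+ n * `|Jr (r n)|.
  elim: n => [|n IH]; first by rewrite expr0 mul1r.
  rewrite (le_trans IH)// exprSr -mulrA ler_wpM2l ?exprn_ge0//.
  by have [_ [_ []]] := sr n.
apply/eqP; rewrite -normr_le0; apply/ler_addgt0Pl => e e0; rewrite addr0.
(* The summand 1 keeps [S] positive for a degenerate rectangle. *)
set S := (b - a + (d - c)) ^+ 2 + 1.
have S0 : 0 < S by rewrite /S ltr_wpDl// sqr_ge0.
have [delta d0 hd] := J_local xab ycd (divr_gt0 e0 S0).
pose N := Num.truncn ((b - a + (d - c)) / delta).
have hN : (b - a + (d - c)) / 2 ^+ N.+1 < delta.
  rewrite ltr_pdivrMr ?exprn_gt0// mulrC -ltr_pdivrMr//.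
  apply: (lt_le_trans (truncnS_gt _)).
  by rewrite -natrX ler_nat ltnW// ltn_expl.
have p2 : 0 < (2 ^+ N.+1 : R) by rewrite exprn_gt0.
have := hd (r N.+1).1.1 (r N.+1).1.2 (r N.+1).2.1 (r N.+1).2.2.
have [[h1 h2 h3] [h4 h5 h6]] := vr N.+1.
have /andP[h7 h8] := xr N.+1; have /andP[h9 h10] := yr N.+1.
rewrite w1 w2.
have l1 : (b - a) / 2 ^+ N.+1 < delta.
  by apply: le_lt_trans hN; rewrite ler_pM2r ?invr_gt0//; lra.
have l2 : (d - c) / 2 ^+ N.+1 < delta.
  by apply: le_lt_trans hN; rewrite ler_pM2r ?invr_gt0//; lra.
move=> /(_ _ _ l1 l2) H; apply: (le_trans (Jn N.+1)).
have {}H : `|Jr (r N.+1)| <= e / S * ((b - a) / 2 ^+ N.+1 + (d - c) / 2 ^+ N.+1) ^+ 2.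
  exact: H.
apply: (le_trans (ler_wpM2l _ H)); first exact: exprn_ge0.
have e4 : 4 = 2 ^+ 2 :> R by rewrite -natrX.
have -> : 4 ^+ N.+1 = (2 ^+ N.+1) ^+ 2 :> R by rewrite e4 -!exprM mulnC.
rewrite [X in X <= _](_ : _ = e * ((b - a + (d - c)) ^+ 2 / S)); last first.
  clearbody S; clear hd H; move: (2 ^+ N.+1) p2 => t t0; field.
  by rewrite !gt_eqF.
by rewrite ler_piMr ?(ltW e0)// ler_pdivrMr// mul1r /S lerDl.
Qed.

End Bisection.

(** * Goursat's theorem for closed real forms *)

Section Goursat.
Context {R : realType}.
Variables (P Q : R -> R -> R) (a b c d : R).
Hypotheses (ab : a <= b) (cd : c <= d).

(** Total differentiability at [(x, y)] with gradient [(p, q)], measured in the l1 norm. *)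
Definition diff2 (F : R -> R -> R) (x y p q : R) := forall e, 0 < e ->
  exists2 delta, 0 < delta & forall x' y', `|x' - x| < delta -> `|y' - y| < delta ->
    `|F x' y' - F x y - (p * (x' - x) + q * (y' - y))| <= e * (`|x' - x| + `|y' - y|).

Lemma diff2_continuous1 (F : R -> R -> R) x y p q : diff2 F x y p q ->
  {for x, continuous (F ^~ y)}.
Proof.
move=> H; apply/cvgrPdist_le => e e0.
have [dl d0 Hd] := H 1 ltr01.
near=> x'; rewrite distrC.
have := Hd x' y; rewrite subrr normr0 mulr0 !addr0 mul1r => /(_ _ d0) Hx.
have xx : `|x' - x| < dl.
  by rewrite distrC; near: x'; apply: cvgr_dist_lt.
have x2 : `|x' - x| <= e / (1 + `|p|).
  rewrite distrC; near: x'; apply: cvgr_dist_le => //.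
  by rewrite divr_gt0// ltr_wpDr.
rewrite -[F x' y - F x y](subrK (p * (x' - x))).
apply: (le_trans (ler_normD _ _)); apply: (le_trans (lerD (Hx xx) (lexx _))).
rewrite normrM -{1}[`|x' - x|]mul1r -mulrDl mulrC.
by rewrite -ler_pdivlMr// ltr_wpDr.
Unshelve. all: by end_near. Qed.

Lemma diff2_swap (F : R -> R -> R) x y p q : diff2 F x y p q ->
  diff2 (fun u v => F v u) y x q p.
Proof.
move=> H e e0; have [dl d0 Hd] := H e e0; exists dl => // y' x' hy hx.
by rewrite [q * _ + _]addrC [`|y' - y| + _]addrC; exact: Hd.
Qed.

Lemma diff2_continuous2 (F : R -> R -> R) x y p q : diff2 F x y p q ->
  {for y, continuous (F x)}.
Proof. by move=> /diff2_swap/diff2_continuous1. Qed.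

Hypothesis closed_form : forall x y, a <= x <= b -> c <= y <= d ->
  exists p k q, diff2 P x y p k /\ diff2 Q x y k q.

Let contP y a' b' : a <= a' -> b' <= b -> c <= y <= d -> cont_on (P ^~ y) a' b'.
Proof.
move=> aa bb ycd x /andP[ax xb].
have xab : a <= x <= b by rewrite (le_trans aa)//= (le_trans xb).
by have [p [k [q [/diff2_continuous1]]]] := closed_form xab ycd.
Qed.

Let contQ x c' d' : c <= c' -> d' <= d -> a <= x <= b -> cont_on (Q x) c' d'.
Proof.
move=> cc dd xab y /andP[cy yd].
have ycd : c <= y <= d by rewrite (le_trans cc)//= (le_trans yd).
by have [p [k [q [_ /diff2_continuous2]]]] := closed_form xab ycd.
Qed.

Let circ a' b' c' d' :=
  itvint (fun x => P x c' - P x d') a' b' + itvint (fun y => Q b' y - Q a' y) c' d'.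

Let contP2 a' b' c' d' : a <= a' -> b' <= b -> c <= c' <= d -> c <= d' <= d ->
  cont_on (fun x => P x c' - P x d') a' b'.
Proof. by move=> aa bb cc dd x xab; apply: cvgB; apply: contP xab. Qed.

Let contQ2 a' b' c' d' : c <= c' -> d' <= d -> a <= a' <= b -> a <= b' <= b ->
  cont_on (fun y => Q b' y - Q a' y) c' d'.
Proof. by move=> aa bb cc dd x xab; apply: cvgB; apply: contQ xab. Qed.

Let itvintDf (f g : R -> R) u v : cont_on f u v -> cont_on g u v ->
  itvint (fun x => f x + g x) u v = itvint f u v + itvint g u v.
Proof. by move=> cf cg; rewrite /itvint RintegralD//; exact: cont_on_integrable. Qed.

(** The circulation is additive under subdivision. Near a point, [P] and [Q] are affine up to a
    small error; the affine parts have circulation 0 because the [y]-slope of [P] equals the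
    [x]-slope of [Q], and the error is small against the squared size, so bisection applies. *)
Lemma closed_form_circulation_eq0 :
  itvint (fun x => P x c - P x d) a b + itvint (fun y => Q b y - Q a y) c d = 0.
Proof.
apply: (@bisection_eq0 R circ a b c d ab cd).
- move=> a' m b' c' d' aa am mb bb cc ccd dd; rewrite /circ.
  have c1 : c <= c' <= d by rewrite cc (le_trans ccd).
  have d1 : c <= d' <= d by rewrite dd (le_trans cc).
  have ma : a <= m <= b by rewrite (le_trans aa)//= (le_trans mb).
  have aa1 : a <= a' <= b by rewrite aa/= (le_trans am)// (le_trans mb).
  have bb1 : a <= b' <= b by rewrite bb (le_trans aa)//= (le_trans am).
  rewrite (@itvintD _ _ a' m b') ?am//; last exact: contP2.
  rewrite (_ : itvint (fun y => Q b' y - Q a' y) c' d' =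
    itvint (fun y => Q m y - Q a' y) c' d' + itvint (fun y => Q b' y - Q m y) c' d'); last first.
    rewrite -itvintDf; [|exact: contQ2|exact: contQ2].
    by congr itvint; apply/funext => y; lra.
  by lra.
- move=> a' b' c' m d' aa aab bb cc cm md dd; rewrite /circ.
  have c1 : c <= c' <= d by rewrite cc (le_trans cm)// (le_trans md).
  have m1 : c <= m <= d by rewrite (le_trans cc)//= (le_trans md).
  have d1 : c <= d' <= d by rewrite dd (le_trans cc)// (le_trans cm).
  have aa1 : a <= a' <= b by rewrite aa/= (le_trans aab).
  have bb1 : a <= b' <= b by rewrite bb (le_trans aa).
  rewrite (@itvintD _ (fun y => Q b' y - Q a' y) c' m d') ?cm//; last exact: contQ2.
  rewrite (_ : itvint (fun x => P x c' - P x d') a' b' =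
    itvint (fun x => P x c' - P x m) a' b' + itvint (fun x => P x m - P x d') a' b'); last first.
    rewrite -itvintDf; [|exact: contP2|exact: contP2].
    by congr itvint; apply/funext => y; lra.
  by lra.
- move=> x y xab ycd e e0.
  have [p [k [q [HP HQ]]]] := closed_form xab ycd.
  (* Each side integral involves a difference of two values, each off by at most [e / 4 * L]. *)
  have e4 : 0 < e / 4 by rewrite divr_gt0.
  have [d1 d10 hP] := HP _ e4; have [d2 d20 hQ] := HQ _ e4.
  exists (Num.min d1 d2); first by rewrite lt_min d10.
  move=> a' b' c' d' [aa ax xb bb] [cc cy yd dd]; rewrite !lt_min => /andP[wd1 wd2] /andP[hd1 hd2].
  set L := b' - a' + (d' - c').
  have ab' : a' <= b' by exact: le_trans xb.
  have cd' : c' <= d' by exact: le_trans yd.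
  have near_x u : a' <= u <= b' -> `|u - x| <= b' - a'.
    by move=> /andP[au ub]; rewrite ler_norml; apply/andP; split; lra.
  have near_y u : c' <= u <= d' -> `|u - y| <= d' - c'.
    by move=> /andP[au ub]; rewrite ler_norml; apply/andP; split; lra.
  have c1 : c <= c' <= d by rewrite cc (le_trans cd').
  have dd1 : c <= d' <= d by rewrite dd (le_trans cc).
  have aa1 : a <= a' <= b by rewrite aa/= (le_trans ab').
  have bb1 : a <= b' <= b by rewrite bb (le_trans aa).
  have cc' : c' <= c' <= d' by rewrite lexx.
  have dd' : c' <= d' <= d' by rewrite lexx andbT.
  have aa' : a' <= a' <= b' by rewrite lexx.
  have bb' : a' <= b' <= b' by rewrite lexx andbT.
  have hP' u v : a' <= u <= b' -> c' <= v <= d' ->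
      `|P u v - P x y - (p * (u - x) + k * (v - y))| <= e / 4 * L.
    move=> /near_x hu /near_y hv; apply: le_trans (hP _ _ _ _) _.
    - exact: le_lt_trans wd1.
    - exact: le_lt_trans hd1.
    - by rewrite ler_wpM2l ?(ltW e4)// lerD.
  have hQ' u v : a' <= u <= b' -> c' <= v <= d' ->
      `|Q u v - Q x y - (k * (u - x) + q * (v - y))| <= e / 4 * L.
    move=> /near_x hu /near_y hv; apply: le_trans (hQ _ _ _ _) _.
    - exact: le_lt_trans wd2.
    - exact: le_lt_trans hd2.
    - by rewrite ler_wpM2l ?(ltW e4)// lerD.
  (* In the difference of the opposite sides the [p]-terms cancel and the constant [k * (c' - d')]
     remains; it is cancelled by the one subtracted in [I2]. *)
  have I1 : `|itvint (fun u => P u c' - P u d') a' b' - (k * (c' - d')) * (b' - a')|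
      <= e / 2 * L * (b' - a').
    apply: itvint_approx => //; first exact: contP2.
    move=> u hu; have h1 := hP' u c' hu cc'; have h2 := hP' u d' hu dd'.
    rewrite (_ : _ - _ = (P u c' - P x y - (p * (u - x) + k * (c' - y))) -
      (P u d' - P x y - (p * (u - x) + k * (d' - y)))); last by ring.
    by apply: (le_trans (ler_normB _ _)); lra.
  have I2 : `|itvint (fun v => Q b' v - Q a' v) c' d' - (k * (b' - a')) * (d' - c')|
      <= e / 2 * L * (d' - c').
    apply: itvint_approx => //; first exact: contQ2.
    move=> u hu; have h1 := hQ' b' u bb' hu; have h2 := hQ' a' u aa' hu.
    rewrite (_ : _ - _ = (Q b' u - Q x y - (k * (b' - x) + q * (u - y))) -
      (Q a' u - Q x y - (k * (a' - x) + q * (u - y)))); last by ring.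
    by apply: (le_trans (ler_normB _ _)); lra.
  rewrite /circ.
  rewrite (_ : _ + _ = (itvint (fun u => P u c' - P u d') a' b' - (k * (c' - d')) * (b' - a')) +
    (itvint (fun v => Q b' v - Q a' v) c' d' - (k * (b' - a')) * (d' - c'))); last by ring.
  apply: (le_trans (ler_normD _ _)); apply: (le_trans (lerD I1 I2)).
  rewrite -mulrDr -/L expr2 mulrA ler_wpM2r//.
    by rewrite /L addr_ge0// subr_ge0.
  by rewrite ler_wpM2r//; [rewrite /L addr_ge0// subr_ge0|lra].
Qed.

End Goursat.

(** * Integrals over the whole line and integrable majorants *)

Section RealLineIntegrals.
Context {R : realType}.
Local Notation mu := (@lebesgue_measure R).
Implicit Types (f g : R -> R).

Definition Rintegrable f := mu.-integrable setT (EFin \o f).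

Lemma Rintegrable_le f g : measurable_fun setT f -> Rintegrable g ->
  (forall x, `|f x| <= g x) -> Rintegrable f.
Proof.
move=> mf ig fg; apply: (le_integrable measurableT _ _ ig).
  exact/measurable_EFinP.
by move=> x _ /=; rewrite lee_fin (le_trans (fg x))// ler_norm.
Qed.

Lemma Rdominated_convergence (fn : nat -> R -> R) f g :
  (forall n, measurable_fun setT (fn n)) -> measurable_fun setT f ->
  Rintegrable g -> (forall n x, `|fn n x| <= g x) ->
  (forall x, fn ^~ x @ \oo --> f x) ->
  (fun n => \int[mu]_x fn n x) @ \oo --> \int[mu]_x f x.
Proof.
move=> mfn mf ig fng fnf.
have [] := @dominated_convergence _ _ R mu setT measurableT
  (fun n => EFin \o fn n) (EFin \o f) (EFin \o g).
- by move=> n; apply/measurable_EFinP; exact: mfn.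
- by apply/measurable_EFinP; exact: mf.
- by apply: aeW => x _; apply: cvg_EFin; [exact: nearW|exact: fnf].
- exact: ig.
- by apply: aeW => x n _ /=; rewrite lee_fin.
move=> If _ H; rewrite /Rintegral; apply: fine_cvg.
rewrite fineK; last exact: (integrable_fin_num measurableT If).
exact: H.
Qed.

Lemma cvg_itvint f : continuous f -> Rintegrable f ->
  (fun n : nat => itvint f (- n%:R) n%:R) @ \oo --> \int[mu]_x f x.
Proof.
move=> cf If.
have mf : measurable_fun setT f by exact: continuous_measurable_fun.
under eq_fun do rewrite /itvint Rintegral_mkcond.
apply: (@Rdominated_convergence _ _ (fun x => `|f x|)) => //.
- by move=> n; apply/(measurable_restrictT f) => //; exact: measurable_funTS.
- exact: (integrable_norm If).
- by move=> n x; rewrite /patch; case: ifPn => // _; rewrite normr0.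
move=> x; apply: cvg_near_cst.
exists (Num.truncn `|x|).+1 => // n /= xn; rewrite /patch mem_set//=.
by rewrite in_itv/= -ler_norml (le_trans (ltW (truncnS_gt _)))// ler_nat.
Qed.

(** The common integrable majorant for functions on horizontal lines; membership in [inH0] provides
    it with the exponent [a = 2]. *)
Definition decay (x : R) : R := (1 + `|x|) ^- 2.

Lemma decay_gt0 x : 0 < decay x.
Proof. by rewrite invr_gt0 exprn_gt0// ltr_wpDr. Qed.

Lemma continuous_decay : continuous decay.
Proof.
move=> x; apply: cvgV; first by rewrite expf_neq0// gt_eqF// ltr_wpDr.
apply: (@continuous_comp _ _ _ (fun x : R => 1 + `|x|) (fun y : R => y ^+ 2)).
  by apply: cvgD; [exact: cvg_cst|exact: norm_continuous].
exact: exprn_continuous.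
Qed.

(** By evenness it suffices to integrate over the half-line, where [- (1 + x)^-1] is an
    antiderivative. *)
Lemma Rintegrable_decay : Rintegrable decay.
Proof.
apply/integrableP; split.
  by apply/measurable_EFinP; apply: continuous_measurable_fun; exact: continuous_decay.
under eq_integral => x _ do rewrite /= ger0_norm ?(ltW (decay_gt0 _))//.
rewrite ge0_symfun_integralT; last 3 first.
- by move=> x; exact/ltW/decay_gt0.
- exact: continuous_decay.
- by move=> x; rewrite /decay/= normrN.
rewrite lte_mul_pinfty//.
rewrite (_ : [set x | 0 <= x] = `[0, +oo[%classic); last first.
  by apply/seteqP; split => x /=; rewrite in_itv/= andbT.
pose F (x : R) : R := - (1 + x)^-1.
have dF (x : R) : 0 < x -> is_derive x 1 F ((1 + x) ^- 2).
  move=> x0; rewrite /F.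
  have x1 : 1 + x != 0 by rewrite gt_eqF// addr_gt0.
  apply: is_derive_eq.
  by rewrite add0r /GRing.scale/= mulr1 opprK.
rewrite (@ge0_continuous_FTC2y _ decay F 0 0) ?ltry//.
- by move=> x _; exact/ltW/decay_gt0.
- by apply: continuous_subspaceT; exact: continuous_decay.
- rewrite -oppr0; apply: cvgN; apply/cvgrPdist_le => e e0; near=> x.
  rewrite sub0r normrN gtr0_norm ?invr_gt0 ?addr_gt0//.
  rewrite -[e]invrK lef_pV2 ?posrE ?invr_gt0 ?addr_gt0//.
  by rewrite ler_wpDl//; near: x; apply: nbhs_pinfty_ge; rewrite num_real.
- by move=> x x0; have [] := dF x x0.
- apply: cvg_at_right_filter; apply: cvgN; apply: cvgV; first by rewrite addr0 oner_neq0.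
  by apply: cvgD; [exact: cvg_cst|exact: cvg_id].
- move=> x; rewrite in_itv/= andbT => x0; rewrite derive1E.
  by have [_ ->] := dF x x0; rewrite /decay gtr0_norm.
Unshelve. all: by end_near. Qed.

Lemma RintegrableZl (c : R) f : Rintegrable f -> Rintegrable (fun x => c * f x).
Proof. by move=> If; exact: (integrableZl measurableT c If). Qed.

Lemma expR_decay (d : R) : 0 < d -> exists2 c : R, 0 < c &
  forall x, expR (- (d * `|x|)) <= c * decay x.
Proof.
(* With this [m], [exp(d y / 2) >= 1 + d y / 2 >= m (1 + y)] for [y >= 0]; squaring gives the
   bound. *)
move=> d0; set m := Num.min 1 (d / 2).
have m0 : 0 < m by rewrite lt_min ltr01 divr_gt0.
exists (m ^- 2) => [|x]; first by rewrite invr_gt0 exprn_gt0.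
rewrite expRN -invfM lef_pV2 ?posrE ?expR_gt0 ?mulr_gt0 ?exprn_gt0 ?ltr_wpDr//.
have x0 := normr_ge0 x; move: `|x| x0 => y y0.
rewrite -exprMn.
have -> : expR (d * y) = expR (d / 2 * y) ^+ 2.
  by rewrite -expRM_natl; congr expR; rewrite -mulr_natl; field.
have h0 : 0 <= m * (1 + y) by rewrite mulr_ge0 ?(ltW m0)// addr_ge0.
rewrite ler_pXn2r// ?nnegrE ?expR_ge0//.
apply: (le_trans _ (expR_ge1Dx _)).
have h1 : m <= 1 by rewrite ge_min lexx.
have h2 : m <= d / 2 by rewrite ge_min lexx orbT.
by rewrite mulrDr mulr1 lerD// ler_wpM2r.
Qed.

Lemma continuous_expRNabs (d : R) : continuous (fun x : R => expR (- (d * `|x|))).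
Proof.
move=> x; apply: continuous_comp; last exact: continuous_expR.
by apply: cvgN; apply: cvgM; [exact: cvg_cst|exact: norm_continuous].
Qed.

Lemma Rintegrable_expRNabs (d : R) : 0 < d -> Rintegrable (fun x => expR (- (d * `|x|))).
Proof.
move=> /expR_decay[c c0 H].
apply: (@Rintegrable_le _ (fun x => c * decay x)).
- by apply: continuous_measurable_fun; exact: continuous_expRNabs.
- exact/RintegrableZl/Rintegrable_decay.
- by move=> x; rewrite ger0_norm ?expR_ge0.
Qed.

End RealLineIntegrals.

(** * Fubini's theorem for kernels dominated by a product *)

Section FubiniR.
Context {R : realType}.
Local Notation mu := (@lebesgue_measure R).
Variables (k : measurableTypeR R -> measurableTypeR R -> R) (p q : R -> R).
Hypotheses (mk : measurable_fun setT (fun z : measurableTypeR R * measurableTypeR R => k z.1 z.2))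
  (Ip : Rintegrable p) (Iq : Rintegrable q)
  (p0 : forall x, 0 <= p x) (q0 : forall x, 0 <= q x)
  (kpq : forall x s, `|k x s| <= p x * q s).

Let section1 x : Rintegrable (k x).
Proof.
apply: (@Rintegrable_le _ _ (fun s => p x * q s)) => //; last exact: RintegrableZl.
exact: (measurableT_comp mk (pair1_measurable x)).
Qed.

Let section2 s : Rintegrable (k^~ s).
Proof.
apply: (@Rintegrable_le _ _ (fun x => q s * p x)); last first.
- by move=> x; rewrite mulrC.
- exact: RintegrableZl.
exact: (measurableT_comp mk (pair2_measurable s)).
Qed.

Lemma RFubini_integrable : (mu \x mu)%E.-integrable setT (fun z => (k z.1 z.2)%:E).
Proof.
apply/integrable12ltyP; first exact/measurable_EFinP.
apply: (@le_lt_trans _ _ (\int[mu]_x (\int[mu]_s q s * p x)%:E)%E).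
  apply: ge0_le_integral => //.
  - by move=> x _; apply: integral_ge0.
  - apply: (@measurable_fun_fubini_tonelli_F _ _ _ _ _ mu (fun z => (`|k z.1 z.2|)%:E)) => //.
    by apply/measurable_EFinP; exact: measurableT_comp.
  - by have /integrableP[] := RintegrableZl (\int[mu]_s q s) Ip.
  move=> x _; rewrite mulrC -RintegralZl//.
  rewrite /Rintegral fineK; last first.
    by apply: integrable_fin_num => //; exact: (RintegrableZl _ Iq).
  apply: ge0_le_integral => //.
  - by apply/measurable_EFinP; apply: measurableT_comp => //;
      have /integrableP[/measurable_EFinP] := section1 x.
  - by have /integrableP[] := RintegrableZl (p x) Iq.
  - by move=> s _ /=; rewrite lee_fin.
exact: (integrable_lty measurableT (RintegrableZl (\int[mu]_s q s) Ip)).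
Qed.

Lemma RFubini : \int[mu]_x \int[mu]_s k x s = \int[mu]_s \int[mu]_x k x s.
Proof.
have := Fubini RFubini_integrable => /=.
under eq_integral => x _ do rewrite -(fineK (integrable_fin_num measurableT (section1 x))).
under [X in _ = X -> _]eq_integral => s _ do
  rewrite -(fineK (integrable_fin_num measurableT (section2 s))).
by rewrite /Rintegral => ->.
Qed.

(** A by-product of Fubini; it later supplies the measurability of Fourier integrals in their
    parameter. *)
Lemma measurable_Rintegral_param : measurable_fun setT (fun s => \int[mu]_x k x s).
Proof.
have := measurable_fubini_G RFubini_integrable; rewrite /fubini_G => H.
exact: (measurableT_comp (fine_measurable measurableT) H).
Qed.

End FubiniR.

(** * Shifting the line of integration *)

Section ContourShift.
Context {R : realType}.
Local Notation mu := (@lebesgue_measure R).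
Variables (P Q : R -> R -> R) (c d K : R).
Hypotheses (cd : c <= d)
  (PQ : forall x y, c <= y <= d -> exists p k q, diff2 P x y p k /\ diff2 Q x y k q)
  (boundP : forall x y, c <= y <= d -> `|P x y| <= K * decay x)
  (boundQ : forall x y, c <= y <= d -> `|Q x y| <= K * decay x).

Lemma decay_line_integrable y : c <= y <= d ->
  continuous (P^~ y) /\ Rintegrable (P^~ y).
Proof.
move=> ycd; have cP : continuous (P^~ y).
  by move=> x; have [p [k [q [/diff2_continuous1]]]] := PQ x ycd.
split=> //; apply: (@Rintegrable_le _ _ (fun x => K * decay x)).
- exact: continuous_measurable_fun.
- exact/RintegrableZl/Rintegrable_decay.
- by move=> x; exact: boundP.
Qed.

(** The circulation around [[-n, n] x [c, d]] is 0. Its vertical sides have fixed length and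
    integrand at most [2 K decay n], so they vanish as [n] grows, while the horizontal sides tend to
    the two line integrals. *)
Lemma contour_shift : \int[mu]_x P x c = \int[mu]_x P x d.
Proof.
have ccd : c <= c <= d by rewrite lexx.
have dcd : c <= d <= d by rewrite lexx cd.
have [cc Ic] := decay_line_integrable ccd.
have [cdd Id] := decay_line_integrable dcd.
apply/eqP; rewrite -subr_eq0; apply/eqP.
rewrite -RintegralB//.
have cB : continuous (fun x => P x c - P x d) by move=> x; apply: cvgB; [exact: cc|exact: cdd].
have IB : Rintegrable (fun x => P x c - P x d) by exact: (integrableB measurableT Ic Id).
have H := cvg_itvint cB IB.
rewrite -(cvg_lim _ H)//; apply: cvg_lim => //.
have K0 : 0 <= K by rewrite -(pmulr_lge0 _ (decay_gt0 0)) (le_trans _ (boundP 0 ccd)).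
apply/cvgrPdist_le => e e0; near=> n; rewrite sub0r normrN.
have n0 : (- n%:R : R) <= n%:R by rewrite ge0_cp.
have := @closed_form_circulation_eq0 R P Q (- n%:R) n%:R c d n0 cd (fun x y _ ycd => PQ x ycd).
move=> /eqP; rewrite addr_eq0 => /eqP ->; rewrite normrN.
have cQ : cont_on (fun y => Q n%:R y - Q (- n%:R) y) c d.
  move=> y ycd; apply: cvgB.
    by have [p [k [q [_ /diff2_continuous2]]]] := PQ n%:R ycd.
  by have [p [k [q [_ /diff2_continuous2]]]] := PQ (- n%:R) ycd.
have := @itvint_approx R _ c d 0 (2 * K * decay n%:R) cd cQ.
rewrite mul0r subr0 => Hb; apply: (le_trans (Hb _)) => [y ycd|].
  rewrite subr0; apply: (le_trans (ler_normB _ _)).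
  have h1 := boundQ n%:R ycd; have := boundQ (- n%:R) ycd.
  by rewrite [decay (- _)]/decay normrN -/(decay _) => h2; lra.
have h : decay (n%:R : R) <= n.+1%:R^-1.
  rewrite /decay normr_nat lef_pV2 ?posrE ?exprn_gt0 ?ltr_wpDr// -natr1 addrC.
  by rewrite expr2 ler_peMl// ?lerDl ?addr_ge0.
have h2 : 2 * K * (d - c) * n.+1%:R^-1 <= e.
  rewrite ler_pdivrMr// -ler_pdivrMl//.
  near: n; exists (Num.truncn (e^-1 * (2 * K * (d - c)))) => // m /= hm.
  by rewrite (le_trans (ltW (truncnS_gt _)))// ler_nat ltnS.
apply: le_trans h2; rewrite -mulrA [decay _ * _]mulrC mulrA.
by rewrite ler_wpM2l// mulr_ge0 ?mulr_ge0// subr_ge0.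
Unshelve. all: by end_near. Qed.

End ContourShift.

(** * The Fourier transform of [exp(-e|s|)] *)

Section AbelKernel.
Context {R : realType}.
Local Notation mu := (@lebesgue_measure R).
Implicit Types (e x t : R).

(** The antiderivative is the real part of [exp((e + ix) t) / (e + ix)]. *)
Lemma is_derive_expcos e x t : e != 0 ->
  is_derive t 1 (fun t => expR (e * t) * (x * sin (t * x) + e * cos (t * x)) / (e ^+ 2 + x ^+ 2))
    (expR (e * t) * cos (t * x)).
Proof.
move=> e0.
have d1 : is_derive t 1 (fun t => e * t) e.
  by apply: is_derive_eq; rewrite /GRing.scale/= mulr1 ?mulr0 ?addr0 ?add0r.
have d2 : is_derive t 1 (fun t => t * x) x.
  by apply: is_derive_eq; rewrite /GRing.scale/= ?mulr1 ?mulr0 ?addr0 ?add0r.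
have dexp : is_derive t 1 (fun t => expR (e * t)) (expR (e * t) * e) by exact: is_derive1_comp.
have dsin : is_derive t 1 (fun t => sin (t * x)) (cos (t * x) * x) by exact: is_derive1_comp.
have dcos : is_derive t 1 (fun t => cos (t * x)) (- sin (t * x) * x) by exact: is_derive1_comp.
have N0 : e ^+ 2 + x ^+ 2 != 0.
  by rewrite paddr_eq0 ?sqr_ge0// negb_and sqrf_eq0 e0.
apply: is_derive_eq; rewrite /GRing.scale/=; field.
exact: N0.
Qed.

Lemma itvint_expcos e x a b : e != 0 -> a < b ->
  itvint (fun t => expR (e * t) * cos (t * x)) a b =
  expR (e * b) * (x * sin (b * x) + e * cos (b * x)) / (e ^+ 2 + x ^+ 2) -
  expR (e * a) * (x * sin (a * x) + e * cos (a * x)) / (e ^+ 2 + x ^+ 2).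
Proof.
move=> e0 ab; rewrite /itvint /Rintegral.
pose F (t : R) := expR (e * t) * (x * sin (t * x) + e * cos (t * x)) / (e ^+ 2 + x ^+ 2).
have dF t : derivable F t 1 by have [] := is_derive_expcos x t e0.
have cF : continuous F.
  by move=> t; apply: differentiable_continuous; exact/derivable1_diffP.
rewrite (@continuous_FTC2 _ _ F)//.
- apply: continuous_subspaceT => t; apply: cvgM.
    by apply: continuous_comp; [apply: cvgM; [exact: cvg_cst|exact: cvg_id]|exact: continuous_expR].
  by apply: continuous_comp; [apply: cvgM; [exact: cvg_id|exact: cvg_cst]|exact: continuous_cos].
- split=> [t _||]; first exact: dF.
    by apply: cvg_at_right_filter; exact: cF.
  by apply: cvg_at_left_filter; exact: cF.
- by move=> t _; rewrite derive1E; have [_ ->] := is_derive_expcos x t e0.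
Qed.

Lemma continuous_abel (e x : R) (f : R -> R) : continuous f ->
  continuous (fun s : R => expR (- (e * `|s|)) * f (s * x)).
Proof.
move=> cf s; apply: cvgM; first exact: continuous_expRNabs.
by apply: continuous_comp; [apply: cvgM; [exact: cvg_id|exact: cvg_cst]|exact: cf].
Qed.

Lemma Rintegrable_abel (e x : R) (f : R -> R) : 0 < e -> continuous f ->
  (forall y, `|f y| <= 1) -> Rintegrable (fun s : R => expR (- (e * `|s|)) * f (s * x)).
Proof.
move=> e0 cf f1; apply: (@Rintegrable_le _ _ (fun s => expR (- (e * `|s|)))).
- by apply: continuous_measurable_fun; exact: continuous_abel.
- exact: Rintegrable_expRNabs.
- by move=> s; rewrite normrM ger0_norm ?expR_ge0// ler_piMr ?expR_ge0.
Qed.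

(** The right side is the Poisson kernel. Each half-line contributes [e / (e^2 + x^2)] from its
    endpoint 0; the far endpoints vanish in the limit. *)
Lemma Rintegral_expcos e x : 0 < e ->
  \int[mu]_s (expR (- (e * `|s|)) * cos (s * x)) = 2 * e / (e ^+ 2 + x ^+ 2).
Proof.
move=> e0.
have ccos : continuous (@cos R) by move=> ?; exact: continuous_cos.
have cc := @continuous_abel e x cos ccos.
have H := cvg_itvint cc (@Rintegrable_abel e x cos e0 ccos (@cos_max R)).
rewrite -(cvg_lim _ H)//; apply: cvg_lim => //.
have N0 : 0 < e ^+ 2 + x ^+ 2 by rewrite ltr_wpDr ?sqr_ge0// exprn_gt0.
(* The index is shifted to [n.+1] because [itvint_expcos] asks for a segment of positive length. *)
have E n : itvint (fun s => expR (- (e * `|s|)) * cos (s * x)) (- n.+1%:R) n.+1%:R =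
   2 * e / (e ^+ 2 + x ^+ 2) + expR (- (e * n.+1%:R)) *
     ((2 * (x * sin (n.+1%:R * x) - e * cos (n.+1%:R * x))) / (e ^+ 2 + x ^+ 2)).
  rewrite (@itvintD _ _ _ 0); last by move=> ? _; exact: cc.
    have -> : itvint (fun s => expR (- (e * `|s|)) * cos (s * x)) (- n.+1%:R) 0 =
        itvint (fun s => expR (e * s) * cos (s * x)) (- n.+1%:R) 0.
      apply: eq_Rintegral => s; rewrite inE/= in_itv/= => /andP[_ s0].
      by rewrite ler0_norm// mulrN opprK.
    have -> : itvint (fun s => expR (- (e * `|s|)) * cos (s * x)) 0 n.+1%:R =
        itvint (fun s => expR (- e * s) * cos (s * x)) 0 n.+1%:R.
      apply: eq_Rintegral => s; rewrite inE/= in_itv/= => /andP[s0 _].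
      by rewrite ger0_norm// mulNr.
    rewrite !itvint_expcos ?oppr_eq0 ?gt_eqF ?oppr_lt0 ?ltr0Sn//.
    rewrite !mulr0 !mul0r expR0 sin0 cos0 mulrN !mulNr sinN cosN sqrrN.
    by field; rewrite gt_eqF.
  by rewrite oppr_le0 ler0n.
rewrite -(cvg_shiftS _).
under eq_fun do rewrite E.
suff G : (fun n : nat => expR (- (e * n.+1%:R)) *
     ((2 * (x * sin (n.+1%:R * x) - e * cos (n.+1%:R * x))) / (e ^+ 2 + x ^+ 2))) @ \oo --> (0 : R).
  by have := cvgD (cvg_cst (2 * e / (e ^+ 2 + x ^+ 2))) G; rewrite addr0; apply.
pose M := 2 * (`|x| + e) / (e ^+ 2 + x ^+ 2).
have M0 : 0 <= M.
  by apply: divr_ge0; [apply: mulr_ge0 => //; apply: addr_ge0 => //; exact: ltW|exact: ltW].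
apply/cvgrPdist_le => r r0; near=> n; rewrite sub0r normrN normrM ger0_norm ?expR_ge0//.
apply: (@le_trans _ _ (expR (- (e * n.+1%:R)) * M)).
  rewrite ler_wpM2l ?expR_ge0// normrM [`|_^-1|]gtr0_norm ?invr_gt0//.
  rewrite ler_pM2r ?invr_gt0// normrM gtr0_norm// ler_pM2l//.
  apply: (le_trans (ler_normB _ _)); rewrite !normrM (gtr0_norm e0) lerD//.
    by rewrite ler_piMr// sin_max.
  by rewrite ler_piMr ?cos_max// ltW.
have h : expR (- (e * n.+1%:R)) <= (e * n.+1%:R)^-1.
  rewrite expRN lef_pV2 ?posrE ?expR_gt0 ?mulr_gt0//.
  by apply: (le_trans _ (expR_ge1Dx _)); rewrite lerDr.
apply: (le_trans (ler_wpM2r M0 h)).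
rewrite mulrC ler_pdivrMr ?mulr_gt0// mulrA -ler_pdivrMl ?mulr_gt0//.
near: n; exists (Num.truncn ((r * e)^-1 * M)) => // m /= hm.
by rewrite (le_trans (ltW (truncnS_gt _)))// ler_nat ltnS.
Unshelve. all: by end_near. Qed.

Lemma Rintegral_expsin e x : 0 < e -> \int[mu]_s (expR (- (e * `|s|)) * sin (s * x)) = 0.
Proof.
move=> e0; have mf : measurable_fun (setT : set (measurableTypeR R))
    (fun s : measurableTypeR R => expR (- (e * `|s|)) * sin (s * x)).
  by apply: continuous_measurable_fun; apply: continuous_abel => ?; exact: continuous_sin.
have := RintegralN mf.
under [X in _ = X -> _]eq_Rintegral do rewrite normrN mulNr sinN mulrN -mulN1r.
set I := (X in X = _ -> _).
have csin : continuous (@sin R) by move=> ?; exact: continuous_sin.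
rewrite RintegralZl//; last exact: (@Rintegrable_abel e x sin e0 csin (@sin_max R)).
by rewrite -/I mulN1r => h; lra.
Qed.

End AbelKernel.

(** * Fourier inversion by Abel means *)

Section AbelInversion.
Context {R : realType}.
Local Notation mu := (@lebesgue_measure R).

(* The value is [2 * pi]; only its positivity matters, so it is left unevaluated. *)
Definition poisson_mass : R := \int[mu]_u (2 / (1 + u ^+ 2)).

Lemma poisson_den_gt0 (u : R) : 0 < 1 + u ^+ 2.
Proof. by rewrite ltr_wpDr ?sqr_ge0. Qed.

Lemma continuous_poisson : continuous (fun u : R => 2 / (1 + u ^+ 2)).
Proof.
move=> u; apply: cvgM; first exact: cvg_cst.
apply: cvgV; first by rewrite gt_eqF// poisson_den_gt0.
by apply: cvgD; [exact: cvg_cst|exact: exprn_continuous].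
Qed.

Lemma Rintegrable_poisson : Rintegrable (fun u : R => 2 / (1 + u ^+ 2)).
Proof.
apply: (@Rintegrable_le _ _ (fun u => 4 * decay u)).
- by apply: continuous_measurable_fun; exact: continuous_poisson.
- exact/RintegrableZl/Rintegrable_decay.
move=> u; have u0 := poisson_den_gt0 u.
rewrite ger0_norm ?divr_ge0 ?(ltW u0)// ler_pdivrMr// mulrAC.
have n0 := normr_ge0 u.
rewrite /decay ler_pdivlMr ?exprn_gt0 ?ltr_wpDr//.
rewrite -(real_normK (num_real u)); have := sqr_ge0 (1 - `|u|); nra.
Qed.

Lemma poisson_mass_gt0 : 0 < poisson_mass.
Proof.
apply: (@lt_le_trans _ _ (itvint (fun u : R => 2 / (1 + u ^+ 2)) 0 1)).
  (* On [[0, 1]] the integrand lies between 1 and 2, hence within [1 / 2] of [3 / 2]; the integral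
     there is at least 1. *)
  have := @itvint_approx R (fun u : R => 2 / (1 + u ^+ 2)) 0 1 (3 / 2) (1 / 2) ler01.
  have c1 : cont_on (fun u : R => 2 / (1 + u ^+ 2)) 0 1 by move=> x _; exact: continuous_poisson.
  move=> /(_ c1) H; have {}H := H _.
  have : `|itvint (fun u : R => 2 / (1 + u ^+ 2)) 0 1 - 3 / 2 * (1 - 0)| <= 1 / 2 * (1 - 0).
    apply: H => x /andP[x0 x1]; have xx := poisson_den_gt0 x.
    rewrite ler_norml; apply/andP; split.
      by rewrite lerBrDr ler_pdivlMr//; nra.
    by rewrite lerBlDr ler_pdivrMr//; nra.
  by rewrite ler_norml => /andP[h _]; lra.
rewrite /itvint Rintegral_mkcond.
pose f (u : R) := 2 / (1 + u ^+ 2).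
have mf : measurable_fun setT f by apply: continuous_measurable_fun; exact: continuous_poisson.
have mI : measurable (`[(0:R), 1]%classic : set (measurableTypeR R)) by exact: measurable_itv.
have p0 (u : R) : 0 <= 2 / (1 + u ^+ 2) by rewrite divr_ge0 ?ltW ?poisson_den_gt0.
apply: le_Rintegral => //.
- apply: (Rintegrable_le _ Rintegrable_poisson) => [|x].
    by apply/(measurable_restrictT f) => //; exact: measurable_funTS.
  by rewrite /patch; case: ifPn => _; rewrite ?normr0 ?ger0_norm.
- exact: Rintegrable_poisson.
- by move=> x _; rewrite /patch; case: ifPn.
Qed.

Variables (a b : R -> R) (K x0 : R).
Hypotheses (ca : continuous a) (cb : continuous b)
  (aK : forall x, `|a x| <= K * decay x) (bK : forall x, `|b x| <= K * decay x).

(** The real part of [(a + ib)(x) exp(is(x - x0))]. The imaginary part is the same expression with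
    [(b, -a)] in place of [(a, b)], so one treatment serves both. *)
Let wave (s x : R) := a x * cos (s * (x - x0)) - b x * sin (s * (x - x0)).

Let K0 : 0 <= K.
Proof. by rewrite -(pmulr_lge0 _ (decay_gt0 0)) (le_trans _ (aK 0)). Qed.

Let cwave s : continuous (wave s).
Proof.
move=> x; have cl : {for x, continuous (fun x => s * (x - x0))}.
  by apply: cvgM; [exact: cvg_cst|apply: cvgB; [exact: cvg_id|exact: cvg_cst]].
by apply: cvgB; apply: cvgM; [exact: ca|apply: continuous_comp => //; exact: continuous_cos
  |exact: cb|apply: continuous_comp => //; exact: continuous_sin].
Qed.

Let wave_bound s x : `|wave s x| <= 2 * K * decay x.
Proof.
apply: (le_trans (ler_normB _ _)); rewrite !normrM.
have h1 : `|a x| * `|cos (s * (x - x0))| <= K * decay x.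
  by rewrite (le_trans _ (aK x))// ler_piMr// cos_max.
have h2 : `|b x| * `|sin (s * (x - x0))| <= K * decay x.
  by rewrite (le_trans _ (bK x))// ler_piMr// sin_max.
by lra.
Qed.

Let Iwave s : Rintegrable (wave s).
Proof.
apply: (@Rintegrable_le _ _ (fun x => 2 * K * decay x)) => //.
- by apply: continuous_measurable_fun; exact: cwave.
- exact/RintegrableZl/Rintegrable_decay.
Qed.

Let Phi (s : R) := \int[mu]_x wave s x.

Let kern e (x s : measurableTypeR R) : R := expR (- (e * `|s|)) * wave s x.

Let mkern e : measurable_fun setT
  (fun z : measurableTypeR R * measurableTypeR R => kern e z.1 z.2).
Proof.
have m1 : measurable_fun setT (fun z : measurableTypeR R * measurableTypeR R => z.1).
  exact: measurable_fst.
have m2 : measurable_fun setT (fun z : measurableTypeR R * measurableTypeR R => z.2).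
  exact: measurable_snd.
have ml : measurable_fun setT
    (fun z : measurableTypeR R * measurableTypeR R => z.2 * (z.1 - x0) : R).
  by apply: measurable_funM => //; apply: measurable_funB.
have comp (f : R -> R) (g : measurableTypeR R * measurableTypeR R -> R) :
    continuous f -> measurable_fun setT g -> measurable_fun setT (f \o g).
  by move=> cf mg; apply: measurableT_comp => //; exact: continuous_measurable_fun.
apply: measurable_funM.
  exact: (comp (fun s : R => expR (- (e * `|s|))) _ (@continuous_expRNabs R e) m2).
apply: measurable_funB; apply: measurable_funM.
- exact: (comp a).
- by apply: (comp cos) => // ?; exact: continuous_cos.
- exact: (comp b).
- by apply: (comp sin) => // ?; exact: continuous_sin.
Qed.

Let kern_bound e x s : `|kern e x s| <= (2 * K * decay x) * expR (- (e * `|s|)).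
Proof.
by rewrite /kern normrM ger0_norm ?expR_ge0// mulrC ler_wpM2r ?expR_ge0.
Qed.

Let kern_int e s : \int[mu]_x kern e x s = expR (- (e * `|s|)) * Phi s.
Proof. by rewrite /kern (RintegralZl _ measurableT (Iwave s)). Qed.

Let Idecay : Rintegrable (fun x : R => 2 * K * decay x).
Proof. exact/RintegrableZl/Rintegrable_decay. Qed.

Let decayK0 x : 0 <= 2 * K * decay x.
Proof. by rewrite !mulr_ge0// ltW// decay_gt0. Qed.

Let mPhi e : 0 < e -> measurable_fun setT (fun s : R => expR (- (e * `|s|)) * Phi s).
Proof.
move=> e0; under eq_fun do rewrite -kern_int.
apply: (@measurable_Rintegral_param R (kern e) (fun x => 2 * K * decay x)
  (fun s : R => expR (- (e * `|s|)))) => //.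
exact: Rintegrable_expRNabs.
Qed.

(** Fubini needs an integrable majorant in [s], which [wave] alone lacks; the factor [exp(-|s|)] is
    inserted to get one and divided out afterwards. *)
Lemma measurable_wave_integral : measurable_fun setT (fun s : R => \int[mu]_x wave s x).
Proof.
have -> : (fun s => \int[mu]_x wave s x) =
    (fun s : R => expR (1 * `|s|) * (expR (- (1 * `|s|)) * Phi s)).
  by apply/funext => s; rewrite mulrA -expRD addrN expR0 mul1r.
apply: measurable_funM; last exact: mPhi.
apply: continuous_measurable_fun => s; apply: continuous_comp; last exact: continuous_expR.
by apply: cvgM; [exact: cvg_cst|exact: norm_continuous].
Qed.

(** After exchanging the integrals, the inner one turns cosines into the Poisson kernel and kills
    the sines; the substitution [x = e u + x0] normalises the kernel. *)
Let abel_mean e : 0 < e -> \int[mu]_s (expR (- (e * `|s|)) * Phi s) =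
  \int[mu]_u (a (e * u + x0) * (2 / (1 + u ^+ 2))).
Proof.
move=> e0; under eq_Rintegral do rewrite -kern_int.
rewrite -(@RFubini R (kern e) (fun x => 2 * K * decay x) (fun s : R => expR (- (e * `|s|))))//; last exact: Rintegrable_expRNabs.
have ccos : continuous (@cos R) by move=> ?; exact: continuous_cos.
have csin : continuous (@sin R) by move=> ?; exact: continuous_sin.
have N0 x : 0 < e ^+ 2 + (x - x0) ^+ 2 by rewrite ltr_wpDr ?sqr_ge0// exprn_gt0.
have inner x : \int[mu]_s kern e x s = a x * (2 * e / (e ^+ 2 + (x - x0) ^+ 2)).
  have Ic := @Rintegrable_abel R e (x - x0) cos e0 ccos (@cos_max R).
  have Is := @Rintegrable_abel R e (x - x0) sin e0 csin (@sin_max R).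
  transitivity (\int[mu]_s (a x * (expR (- (e * `|s|)) * cos (s * (x - x0))) -
      b x * (expR (- (e * `|s|)) * sin (s * (x - x0))))).
    by apply: eq_Rintegral => s _; rewrite /kern /wave; ring.
  rewrite RintegralB//; [|exact: (RintegrableZl (a x) Ic)|exact: (RintegrableZl (b x) Is)].
  rewrite RintegralZl// RintegralZl// Rintegral_expcos// Rintegral_expsin//.
  by rewrite mulr0 subr0.
under eq_Rintegral do rewrite inner.
have cf : continuous (fun x => a x * (2 * e / (e ^+ 2 + (x - x0) ^+ 2))).
  move=> x; apply: cvgM; first exact: ca.
  apply: cvgM; first exact: cvg_cst.
  apply: cvgV; first by rewrite gt_eqF.
  apply: cvgD; first exact: cvg_cst.
  apply: (@continuous_comp _ _ _ (fun x : R => x - x0) (fun y : R => y ^+ 2)).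
    by apply: cvgB; [exact: cvg_id|exact: cvg_cst].
  exact: exprn_continuous.
rewrite (Rintegral_affine x0 e0); last exact: continuous_measurable_fun.
have Icomp : Rintegrable (fun u : R => a (e * u + x0) * (2 / (1 + u ^+ 2)) / e).
  apply: (@Rintegrable_le _ _ (fun u => (K / e) * (2 / (1 + u ^+ 2)))).
  - apply: continuous_measurable_fun => u; apply: cvgM; last exact: cvg_cst.
    apply: cvgM; last exact: continuous_poisson.
    apply: (@continuous_comp _ _ _ (fun u : R => e * u + x0) a); last exact: ca.
    by apply: cvgD; [apply: cvgM; [exact: cvg_cst|exact: cvg_id]|exact: cvg_cst].
  - exact/RintegrableZl/Rintegrable_poisson.
  move=> u; rewrite !normrM [`|2|]ger0_norm// [`|e^-1|]ger0_norm ?invr_ge0 ?(ltW e0)//.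
  rewrite [`|_^-1|]ger0_norm ?invr_ge0 ?(ltW (poisson_den_gt0 u))// mulrAC.
  rewrite ler_wpM2r ?divr_ge0 ?(ltW (poisson_den_gt0 u))// ler_wpM2r ?invr_ge0 ?(ltW e0)//.
  apply: (le_trans (aK _)); rewrite ler_piMr//.
  by rewrite invf_le1 ?exprn_gt0 ?ltr_wpDr// exprn_ege1// lerDl.
have E2 (u : R) : a (e * u + x0) * (2 * e / (e ^+ 2 + (e * u + x0 - x0) ^+ 2)) =
    a (e * u + x0) * (2 / (1 + u ^+ 2)) / e.
  rewrite addrK exprMn; have hu := poisson_den_gt0 u.
  have -> : e ^+ 2 + e ^+ 2 * u ^+ 2 = e ^+ 2 * (1 + u ^+ 2) by ring.
  by field; rewrite !gt_eqF.
under eq_Rintegral do rewrite E2.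
rewrite -(RintegralZl _ measurableT Icomp).
by apply: eq_Rintegral => u _; rewrite mulrC divfK// gt_eqF.
Qed.

Variables (H delta : R).
Hypotheses (delta0 : 0 < delta)
  (PhiH : forall s, `|\int[mu]_x wave s x| <= H * expR (- (delta * `|s|))).

(** Let [e] tend to 0 in [abel_mean]. The left side converges by domination through [PhiH]; the
    right side is [a] averaged around [x0] at scale [e], and converges by continuity of [a] with
    majorant [K] times the Poisson density. *)
Lemma abel_inversion : \int[mu]_s (\int[mu]_x wave s x) = poisson_mass * a x0.
Proof.
pose e n : R := n.+1%:R^-1.
have e0 n : 0 < e n by rewrite invr_gt0.
have ecvg : e @ \oo --> (0 : R) by exact: cvg_harmonic.
have IH : Rintegrable (fun s : R => H * expR (- (delta * `|s|))).
  exact/RintegrableZl/Rintegrable_expRNabs.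
have L1 : (fun n => \int[mu]_s (expR (- (e n * `|s|)) * Phi s)) @ \oo --> \int[mu]_s Phi s.
  apply: (Rdominated_convergence _ _ IH) => [n|||s]; first exact: mPhi.
  - exact: measurable_wave_integral.
  - move=> n s; rewrite normrM ger0_norm ?expR_ge0//.
    apply: (le_trans _ (PhiH s)); rewrite ler_piMl//.
    by rewrite -expR0 ler_expR oppr_le0 mulr_ge0// ltW.
  have G0 : (fun n => - (e n * `|s|)) @ \oo --> (0 : R).
    by have := cvgN (cvgM ecvg (cvg_cst `|s|)); rewrite mul0r oppr0; apply.
  have G : (fun n => expR (- (e n * `|s|))) @ \oo --> (1 : R).
    rewrite -expR0; apply: (@cvg_comp _ _ _ (fun n => - (e n * `|s|)) expR _ (nbhs (0 : R))) => //.
    exact: continuous_expR.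
  by have := cvgM G (cvg_cst (Phi s)); rewrite mul1r; apply.
have L2 : (fun n => \int[mu]_u (a (e n * u + x0) * (2 / (1 + u ^+ 2)))) @ \oo -->
    \int[mu]_u (a x0 * (2 / (1 + u ^+ 2))).
  have cl (r : R) : continuous (fun u : R => a (r * u + x0)).
    move=> u; apply: (@continuous_comp _ _ _ (fun u : R => r * u + x0) a); last exact: ca.
    by apply: cvgD; [apply: cvgM; [exact: cvg_cst|exact: cvg_id]|exact: cvg_cst].
  apply: (Rdominated_convergence _ _ (RintegrableZl K Rintegrable_poisson)).
  - move=> n; apply: continuous_measurable_fun => u.
    by apply: cvgM; [exact: cl|exact: continuous_poisson].
  - apply: continuous_measurable_fun => u.
    by apply: cvgM; [exact: cvg_cst|exact: continuous_poisson].
  - move=> n u; have hu := poisson_den_gt0 u.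
    rewrite normrM [`|2 / _|]ger0_norm ?divr_ge0 ?(ltW hu)// ler_wpM2r ?divr_ge0 ?(ltW hu)//.
    apply: (le_trans (aK _)); rewrite ler_piMr//.
    by rewrite invf_le1 ?exprn_gt0 ?ltr_wpDr// exprn_ege1// lerDl.
  move=> u; have G0 : (fun n => e n * u + x0) @ \oo --> x0.
    by have := cvgD (cvgM ecvg (cvg_cst u)) (cvg_cst x0); rewrite mul0r add0r; apply.
  apply: cvgM; last exact: cvg_cst.
  by apply: (@cvg_comp _ _ _ (fun n => e n * u + x0) a _ (nbhs x0)) => //; exact: ca.
have L3 : (fun n => \int[mu]_u (a (e n * u + x0) * (2 / (1 + u ^+ 2)))) @ \oo -->
    \int[mu]_s Phi s.
  by move: L1; under eq_fun do rewrite abel_mean//.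
rewrite (cvg_unique _ L3 L2)// RintegralZl//; last exact: Rintegrable_poisson.
by rewrite mulrC.
Qed.

End AbelInversion.

(** * Growth of admissible weights *)

Section Growth.
Context {R : realType}.
Local Notation mu := (@lebesgue_measure R).

Lemma lebesgue_measure_reflect (t : R) (A : set (measurableTypeR R)) : measurable A ->
  mu ((fun s => t - s) @^-1` A) = mu A.
Proof.
move=> mA.
have mB : measurable ((fun x : measurableTypeR R => (1 * x + t : measurableTypeR R)) @^-1` A).
  by rewrite -[_ @^-1` _]setTI; exact: (measurable_affine 1 t).
have := lebesgue_measureN mB; rewrite /pushforward.
have := lebesgue_measure_affine t ltr01 mA; rewrite mul1e => <- <-.
by congr (mu _); apply/seteqP; split => s /=; rewrite mul1r addrC.
Qed.

Variables (v : R -> R) (c : R).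
Hypothesis mv : measurable_fun (setT : set (measurableTypeR R)) (v : measurableTypeR R -> R).
Hypothesis v1 : forall s, 1 <= v s.
Hypothesis vD : forall s t, v (s + t) <= c * (v s + v t).

Let c_ge0 : 0 <= c.
Proof.
have h := vD 0 0; have h1 := v1 (0 + 0); have h0 := v1 0.
rewrite leNgt; apply/negP => cn.
have : c * (v 0 + v 0) <= 0 by rewrite nmulr_rle0//; lra.
by lra.
Qed.

(* Steinhaus argument: if [v <= n] off a small set, every [t] in [-1, 1] is a
   sum of two points where [v <= n]. *)
Lemma admissible_bounded_near0 : exists B, forall t, `|t| <= 1 -> v t <= B.
Proof.
pose E n : set (measurableTypeR R) := `[(-1)%R, 1%R]%classic `&` [set s | n%:R < v s].
have mE n : measurable (E n).
  apply: measurableI; first exact: measurable_itv.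
  have := mv measurableT (measurable_itv (Interval (BRight (n%:R : R)) (BInfty R false))); rewrite setTI.
  by congr measurable; apply/seteqP; split => s /=; rewrite in_itv/= andbT.
have capE : \bigcap_n E n = set0.
  apply/seteqP; split => // s H; have [_ /=] := H (Num.truncn (v s)).+1 I.
  by rewrite ltNge (ltW (truncnS_gt _)).
have : mu \o E @ \oo --> mu (\bigcap_n E n).
  apply: nonincreasing_cvg_mu => //.
  - apply: (@le_lt_trans _ _ (mu `[(-1)%R, 1%R]%classic)).
      by apply: le_measure; rewrite ?inE//; exact: subIsetl.
    by rewrite lebesgue_measure_itv/=; case: ifP => _; rewrite ltry.
  - by rewrite capE.
  - move=> m n mn; apply/subsetPset => s [h1 h2]; split => //=.
    by apply: le_lt_trans h2; rewrite ler_nat.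
rewrite capE measure0 => /fine_cvgP[[N1 _ fE]] /cvgrPdist_lt /(_ 2^-1).
case=> [|N2 _ hE]; first by rewrite invr_gt0.
pose n := maxn N1 N2.
have En : (mu (E n) < 2^-1%:E)%E.
  have h1 := fE n (leq_maxl _ _); have := hE n (leq_maxr _ _).
  rewrite /= sub0r normrN => h2.
  rewrite -[mu (E n)]fineK//; rewrite lte_fin; apply: le_lt_trans h2; exact: ler_norm.
exists (c * (n%:R + n%:R)) => t t1.
suff [s [h1 h2]] : exists s, v s <= n%:R /\ v (t - s) <= n%:R.
  rewrite -{1}(subrKC s t); apply: (le_trans (vD _ _)).
  by rewrite ler_wpM2l// lerD.
apply: contrapT => /forallNP H.
(* A segment of length 1 such that [s] and [t - s] both lie in [[-1, 1]] for [s] in it. Were there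
   no suitable [s], [J] would be covered by [E n] and its reflection, each of measure below
   [1 / 2]. *)
pose J : interval R := (if 0 <= t then `[0, 1] else `[-1, 0])%R.
have JE : [set` J] `<=` E n `|` (fun s => t - s) @^-1` E n.
  move=> s sJ.
  have [s1 s2] : `[(-1)%R, 1%R]%classic s /\ `[(-1)%R, 1%R]%classic (t - s).
    move: sJ t1; rewrite /J ler_norml; case: ifPn => t0 /=; rewrite !in_itv/=;
    move=> /andP[a1 a2] /andP[a3 a4]; move: t0; rewrite -?ltNge => t0;
    by split; apply/andP; split; lra.
  have [h|h] := leP (v s) n%:R; last by left.
  right; split => //=; rewrite ltNge; apply/negP => h'.
  by apply: (H s).
have mts : measurable_fun (setT : set (measurableTypeR R))
    (fun s : measurableTypeR R => t - s : measurableTypeR R).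
  apply: continuous_measurable_fun => x.
  by apply: cvgB; [exact: cvg_cst|exact: cvg_id].
have mEn : measurable ((fun s : measurableTypeR R => t - s : measurableTypeR R) @^-1` E n).
  by rewrite -[_ @^-1` _]setTI; exact: (mts measurableT _ (mE n)).
have muJ : mu [set` J] = 1%:E.
  rewrite /J; case: ifPn => _; rewrite lebesgue_measure_itv/= lte_fin ?ltr01 ?ltrN10 -EFinB.
    by rewrite subr0.
  by rewrite sub0r opprK.
have : (mu [set` J] <= mu (E n) + mu (E n))%E.
  rewrite -{2}(lebesgue_measure_reflect t (mE n)).
  apply: (le_trans _ (measureU2 _ (mE n) mEn)).
  apply: le_measure; rewrite ?inE//; exact: measurableU.
rewrite muJ leNgt => /negP; apply.
have -> : 1%:E = (2^-1%:E + 2^-1%:E)%E :> \bar R by rewrite -EFinD; congr EFin; lra.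
exact: lteD.
Qed.

(** Doubling the argument costs a factor [2 c]; for large [|t|] this is absorbed by the gain
    [exp(d |t| / 2)] of the exponential. Induction over dyadic ranges starts from the bound near
    0. *)
Lemma admissible_subexponential (d : R) : 0 < d ->
  exists2 B, 0 < B & forall s, v s <= B * expR (d * `|s|).
Proof.
move=> d0.
have half s : v s <= 2 * c * v (s / 2).
  by rewrite {1}(_ : s = s / 2 + s / 2); [apply: (le_trans (vD _ _)); lra|lra].
have c2 : 1 <= 2 * c.
  have h := vD 0 0; have h0 := v1 0; rewrite addr0 in h.
  have v0 : 0 < v 0 by lra.
  rewrite -(ler_pM2r v0) mul1r; lra.
have bounded n : exists B, forall t, `|t| <= 2 ^+ n -> v t <= B.
  elim: n => [|n [B HB]]; first exact: admissible_bounded_near0.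
  exists (2 * c * B) => t ht; apply: (le_trans (half t)).
  rewrite ler_wpM2l ?mulr_ge0//; apply: HB.
  by rewrite normrM [`|2^-1|]gtr0_norm ?invr_gt0// ler_pdivrMr// -exprSr.
(* Beyond [2 ^ n0] one has [2 c <= d |t| / 2 <= exp(d |t| / 2)]. *)
pose n0 := (Num.truncn (2 * (2 * c) / d)).+1.
have [B0 HB0] := bounded n0.
pose B := Num.max B0 1.
have B1 : 1 <= B by rewrite le_max lexx orbT.
exists B; first exact: lt_le_trans B1.
suff H n : forall t, `|t| <= 2 ^+ n -> v t <= B * expR (d * `|t|).
  move=> s; apply: (H (Num.truncn `|s|).+1); apply: (le_trans (ltW (truncnS_gt _))).
  by rewrite -natrX ler_nat ltnW// ltn_expl.
have e1 t : 1 <= expR (d * `|t|) by rewrite -expR0 ler_expR mulr_ge0// ltW.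
have small t : `|t| <= 2 ^+ n0 -> v t <= B * expR (d * `|t|).
  move=> /HB0 h; apply: (le_trans h); apply: (@le_trans _ _ B); first by rewrite le_max lexx.
  by rewrite ler_peMr//; lra.
elim: n => [t ht|n IH t ht].
  by apply: small; apply: (le_trans ht); rewrite expr0 exprn_ege1// ler1n.
have [/small//|tL] := leP `|t| (2 ^+ n0).
apply: (le_trans (half t)).
have ht2 : `|t / 2| = `|t| / 2 by rewrite normrM [`|2^-1|]gtr0_norm ?invr_gt0.
have := IH (t / 2); rewrite ht2 ler_pdivrMr// -exprSr => /(_ ht) h.
have -> : d * `|t| = d * (`|t| / 2) + d * (`|t| / 2) by lra.
rewrite expRD mulrA [X in _ <= X]mulrC; apply: ler_pM => //.
- by rewrite mulr_ge0.
- by rewrite (le_trans _ (v1 _)).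
apply: (le_trans _ (expR_ge1Dx _)); apply: (@le_trans _ _ (d * (`|t| / 2))); last by rewrite lerDr.
have : 2 * (2 * c) / d < `|t|.
  apply: (lt_trans (truncnS_gt _)); apply: le_lt_trans tL.
  by rewrite -natrX ler_nat ltnW// ltn_expl.
rewrite ltr_pdivrMr// => h4; lra.
Qed.

End Growth.

(** * Complex differentiability and the exponential *)

Section ComplexDerivative.
Context {R : realType}.
Local Notation C := R[i].
Implicit Types (z u w l : C) (h : C -> C).

Lemma normC_cabs z : `|z| = rC (cabs z).
Proof. by rewrite normc_def; case: z. Qed.

Lemma lerC (a b : R) : (rC a <= rC b) = (a <= b).
Proof. by rewrite /rC lecE/= eqxx. Qed.

Lemma ltrC (a b : R) : (rC a < rC b) = (a < b).
Proof. by rewrite /rC ltcE/= eqxx. Qed.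

Lemma rC_inj (a b : R) : rC a = rC b -> a = b.
Proof. by case. Qed.

Lemma rC_mul (a b : R) : rC (a * b) = rC a * rC b.
Proof. by rewrite /rC; apply/eqP; rewrite eq_complex/= !mul0r !mulr0 subr0 addr0 !eqxx. Qed.

Lemma rC_add (a b : R) : rC (a + b) = rC a + rC b.
Proof. by rewrite /rC; apply/eqP; rewrite eq_complex/= addr0 !eqxx. Qed.

Lemma cabs_ge0 z : 0 <= cabs z.
Proof. exact: sqrtr_ge0. Qed.

Lemma cabsM z w : cabs (z * w) = cabs z * cabs w.
Proof. by apply: rC_inj; rewrite rC_mul -!normC_cabs normrM. Qed.

Lemma cabsD z w : cabs (z + w) <= cabs z + cabs w.
Proof. by rewrite -lerC rC_add -!normC_cabs ler_normD. Qed.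

Lemma ler_Re_cabs z : `|reC z| <= cabs z.
Proof. by rewrite -sqrtr_sqr ler_wsqrtr// lerDl sqr_ge0. Qed.

Lemma ler_Im_cabs z : `|imC z| <= cabs z.
Proof. by rewrite -sqrtr_sqr ler_wsqrtr// lerDr sqr_ge0. Qed.

Lemma cabs_le z : cabs z <= `|reC z| + `|imC z|.
Proof.
rewrite -[leRHS]ger0_norm ?addr_ge0// -sqrtr_sqr ler_wsqrtr// sqrrD.
by rewrite !real_normK ?num_real// lerD2r lerDl mulrn_wge0// mulr_ge0.
Qed.

Lemma cabs_sqr z : cabs z ^+ 2 = reC z ^+ 2 + imC z ^+ 2.
Proof. by rewrite sqr_sqrtr// addr_ge0 ?sqr_ge0. Qed.

(** The first-order expansion with real tolerances and without a quotient: [R[i]] has its norm in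
    [R[i]], and product and chain rule become plain estimates of the remainder. *)
Definition cdiff h z l := forall e : R, 0 < e -> exists2 d : R, 0 < d &
  forall u, cabs u < d -> cabs (h (z + u) - h z - l * u) <= e * cabs u.

Lemma derivable_cdiff h z : derivable (h : C^o -> C^o) z 1 -> exists l, cdiff h z l.
Proof.
move=> /cvg_ex[l /cvgrPdist_le H]; exists l => e e0.
have re0 : 0 < rC e by rewrite -[0]/(rC 0) ltrC.
have /nbhs_ballP[d /= d0 Hd] := H _ re0.
have [d' d'E d'0] : exists2 d' : R, d = rC d' & 0 < d'.
  by move: d0; case: (d) => p q; rewrite ltcE/= => /andP[/eqP -> ?]; exists p.
exists d' => // u ud; have [->|u0] := eqVneq u 0.
  rewrite addr0 subrr mulr0 subrr (_ : cabs 0 = 0) ?mulr0//.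
  by rewrite /cabs/= expr0n/= addr0 sqrtr0.
have := Hd u; rewrite -ball_normE /ball_/= sub0r normrN normC_cabs d'E ltrC.
move=> /(_ ud u0); rewrite normC_cabs lerC => Hu.
rewrite (_ : _ - _ - _ = - (u * (l - u^-1 *: (h (u *: 1 + z) - h z)))); last first.
  rewrite /GRing.scale/= mulrBr mulrA divff// mul1r mulr1 opprB [z + u]addrC.
  by rewrite [l * u]mulrC.
rewrite (_ : cabs (- _) = cabs (u * (l - u^-1 *: (h (u *: 1 + z) - h z)))); last first.
  by rewrite /cabs; congr Num.sqrt; case: (u * _) => p q /=; rewrite !sqrrN.
by rewrite cabsM mulrC ler_wpM2r// cabs_ge0.
Qed.

Lemma cdiff_derivable h z l : cdiff h z l -> derivable (h : C^o -> C^o) z 1.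
Proof.
move=> H; apply/cvg_ex; exists l; apply/cvgrPdist_le => e e0.
have [e' eE e'0] : exists2 e' : R, e = rC e' & 0 < e'.
  by move: e0; case: (e) => p q; rewrite ltcE/= => /andP[/eqP -> ?]; exists p.
have [d d0 Hd] := H _ e'0.
apply/nbhs_ballP; exists (rC d); first by rewrite /= -[0]/(rC 0) ltrC.
move=> u /=; rewrite -ball_normE /ball_/= sub0r normrN normC_cabs ltrC => ud u0.
rewrite eE normC_cabs lerC.
have u1 : 0 < cabs u by rewrite -ltrC -normC_cabs normr_gt0.
rewrite -(ler_pM2r u1); apply: le_trans (Hd u ud); rewrite -cabsM.
rewrite (_ : _ - _ - _ = - ((l - u^-1 *: (h (u *: 1 + z) - h z)) * u)); last first.
  rewrite /GRing.scale/= mulrBl mulrAC mulVf// mul1r mulr1 opprB [z + u]addrC.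
  by [].
by rewrite le_eqVlt; apply/orP; left; apply/eqP; rewrite /cabs; congr Num.sqrt;
  case: (_ * u) => p q /=; rewrite !sqrrN.
Qed.

(** The Cauchy-Riemann equations: they are read off from multiplication by [l]. *)
Lemma cdiff_diff2 h x y l : cdiff h (Complex x y) l ->
  diff2 (fun a b => reC (h (Complex a b))) x y (reC l) (- imC l) /\
  diff2 (fun a b => imC (h (Complex a b))) x y (imC l) (reC l).
Proof.
move=> H.
have K e : 0 < e -> exists2 d : R, 0 < d & forall x' y', `|x' - x| < d -> `|y' - y| < d ->
    cabs (h (Complex x' y') - h (Complex x y) - l * Complex (x' - x) (y' - y))
      <= e * (`|x' - x| + `|y' - y|).
  move=> e0; have [d d0 Hd] := H e e0; exists (d / 2); first by rewrite divr_gt0.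
  move=> x' y' hx hy; have := Hd (Complex (x' - x) (y' - y)).
  have -> : Complex x y + Complex (x' - x) (y' - y) = Complex x' y'.
    by apply/eqP; rewrite eq_complex/= ![_ + (_ - _)]addrC !subrK !eqxx.
  have hc := cabs_le (Complex (x' - x) (y' - y)).
  move=> Hu; apply: le_trans (Hu _) _; first by apply: le_lt_trans hc _ => /=; lra.
  by rewrite ler_wpM2l// ltW.
split=> e e0; have [d d0 Hd] := K e e0; exists d => // x' y' hx hy;
  apply: le_trans (Hd x' y' hx hy).
  apply: le_trans (ler_Re_cabs _); clear H K Hd; move: (h _) (h _) l => [p q] [r t] [m n] /=.
  by rewrite mulNr.
apply: le_trans (ler_Im_cabs _); clear H K Hd; move: (h _) (h _) l => [p q] [r t] [m n] /=.
by rewrite [m * _ + _]addrC.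
Qed.

(** Both sides come from [1 + x <= exp x], at [a] and at [- a]; the latter gives
    [exp a * (1 - a) <= 1], hence [exp a <= 2] in this range. *)
Lemma expR_taylor1 (a : R) : `|a| <= 2^-1 -> `|expR a - 1 - a| <= 2 * a ^+ 2.
Proof.
move=> ha; have h1 := expR_ge1Dx a; have h2 := expR_ge1Dx (- a).
have /andP[h3 h4] : - 2^-1 <= a <= 2^-1 by rewrite -ler_norml.
rewrite ger0_norm; last by lra.
have h5 : expR a * (1 - a) <= 1.
  by rewrite -[leRHS]expR0 -(subrr a) expRD ler_pM2l ?expR_gt0.
have e0 := expR_gt0 a.
have h6 : expR a <= 2 by nra.
nra.
Qed.

Lemma sin_le_id (b : R) : `|sin b| <= `|b|.
Proof.
wlog b0 : b / 0 <= b => [H|].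
  have [/H//|/ltW b0] := leP 0 b.
  by rewrite -[`|sin b|]normrN -sinN -[`|b|]normrN; apply: H; rewrite oppr_ge0.
have dsin (x : R) : x \in `]0, b[%R -> is_derive x 1 sin (cos x) by move=> _; exact: is_derive_sin.
have csin : {within `[0, b], continuous sin}.
  by apply: continuous_subspaceT => x; exact: continuous_sin.
have [t _] := MVT_segment b0 dsin csin.
rewrite sin0 !subr0 => ->; rewrite normrM ler_piMl//; exact: cos_max.
Qed.

Lemma cos_taylor1 (b : R) : `|cos b - 1| <= b ^+ 2.
Proof.
have -> : cos b - 1 = - (2 * sin (b / 2) ^+ 2).
  rewrite {1}(_ : b = b / 2 + b / 2); last by lra.
  by rewrite cosD -!expr2 cos2sin2; ring.
rewrite normrN normrM normrX [`|2|]gtr0_norm//; have h := sin_le_id (b / 2).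
 have h1 : `|sin (b / 2)| ^+ 2 <= `|b / 2| ^+ 2 by rewrite ler_pXn2r ?nnegrE.
rewrite real_normK ?num_real// in h1 *; rewrite real_normK ?num_real// in h1 *.
have b2 := sqr_ge0 b.
by rewrite exprMn in h1; lra.
Qed.

Lemma sin_taylor1 (b : R) : `|b| <= 1 -> `|sin b - b| <= b ^+ 2.
Proof.
wlog b0 : b / 0 <= b => [H|b1].
  have [/H//|/ltW b0] := leP 0 b.
  move=> hb; have := H (- b); rewrite oppr_ge0 normrN sqrrN sinN opprK => /(_ b0 hb).
  by rewrite -normrN opprD opprK.
have dsin (x : R) : x \in `]0, b[%R -> is_derive x 1 (fun x => sin x - x) (cos x - 1).
  by move=> _; apply: is_derive_eq.
have csin : {within `[0, b], continuous (fun x => sin x - x)}.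
  by apply: continuous_subspaceT => x; apply: cvgB; [exact: continuous_sin|exact: cvg_id].
have [t] := MVT_segment b0 dsin csin.
rewrite in_itv/= => /andP[t0 tb]; rewrite sin0 !subr0 => ->.
rewrite normrM (ger0_norm b0) expr2 ler_wpM2r//.
apply: (le_trans (cos_taylor1 t)); rewrite (ger0_norm b0) in b1.
nra.
Qed.

Lemma cexpD z w : cexp (z + w) = cexp z * cexp w.
Proof.
case: z w => [a b] [c d]; apply/eqP; rewrite eq_complex /cexp/=.
by rewrite expRD cosD sinD; apply/andP; split; apply/eqP; ring.
Qed.

Lemma cabs_cexp z : cabs (cexp z) = expR (reC z).
Proof.
rewrite /cabs/= !exprMn -mulrDr cos2Dsin2 mulr1 sqrtr_sqr ger0_norm// expR_ge0.
Qed.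

Lemma cexp_taylor1 u : cabs u <= 2^-1 -> cabs (cexp u - 1 - u) <= 4 * cabs u ^+ 2.
Proof.
move=> hu; have ha := le_trans (ler_Re_cabs u) hu; have hb := le_trans (ler_Im_cabs u) hu.
rewrite cabs_sqr; case: u ha hb {hu} => a b /= ha hb.
apply: (le_trans (cabs_le _)) => /=; rewrite subr0.
have b1 : `|b| <= 1 by lra.
have := expR_taylor1 ha; have := cos_taylor1 b; have := sin_taylor1 b1; have := sin_le_id b.
have e0 := expR_gt0 a.
set E := expR a in e0 *; set c := cos b; set s := sin b => h1 h2 h3 h4.
have a2 : `|a| ^+ 2 = a ^+ 2 by rewrite real_normK ?num_real.
have b2 : `|b| ^+ 2 = b ^+ 2 by rewrite real_normK ?num_real.
have na := normr_ge0 a; have nb := normr_ge0 b; have na' := ler_norm a.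
have E2 : E <= 2 by have := ler_norm (E - 1 - a); nra.
have H1 : `|E * c - 1 - a| <= 2 * a ^+ 2 + 2 * b ^+ 2.
  rewrite (_ : _ - _ - _ = (E - 1 - a) + E * (c - 1)); last by ring.
  apply: (le_trans (ler_normD _ _)); rewrite lerD// normrM (gtr0_norm e0).
  by apply: ler_pM => //; exact: ltW.
have H2 : `|E - 1| <= 2 * `|a|.
  rewrite (_ : E - 1 = (E - 1 - a) + a); last by ring.
  apply: (le_trans (ler_normD _ _)); nra.
have H3 : `|E * s - b| <= 2 * `|a| * `|b| + b ^+ 2.
  rewrite (_ : _ - _ = (E - 1) * s + (s - b)); last by ring.
  by apply: (le_trans (ler_normD _ _)); rewrite lerD// normrM; apply: ler_pM.
have H4 : 2 * `|a| * `|b| <= a ^+ 2 + b ^+ 2.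
  by rewrite -a2 -b2; have := sqr_ge0 (`|a| - `|b|); nra.
have := sqr_ge0 a; lra.
Qed.

Lemma cdiff_cexp z : cdiff cexp z (cexp z).
Proof.
move=> e e0; pose r := expR (reC z); have r0 : 0 < r := expR_gt0 _.
exists (Num.min 2^-1 (e / (4 * r))).
  by rewrite lt_min invr_gt0 ltr0n/= divr_gt0// mulr_gt0.
move=> u; rewrite lt_min => /andP[u1 u2].
rewrite cexpD (_ : _ - _ - _ = cexp z * (cexp u - 1 - u)); last by ring.
rewrite cabsM cabs_cexp -/r; apply: (le_trans (ler_wpM2l (ltW r0) (cexp_taylor1 (ltW u1)))).
rewrite expr2 !mulrA ler_wpM2r ?cabs_ge0//.
by move: (ltW u2); rewrite ler_pdivlMr ?mulr_gt0// => h; apply: le_trans h; rewrite mulrC; lra.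
Qed.

Lemma cdiff_comp (g f : C -> C) z l m : cdiff f z l -> cdiff g (f z) m ->
  cdiff (g \o f) z (m * l).
Proof.
move=> Hf Hg e e0.
have l0 := cabs_ge0 l; have m0 := cabs_ge0 m.
have L0 : 0 < cabs l + 1 by rewrite ltr_wpDl.
have M0 : 0 < cabs m + 1 by rewrite ltr_wpDl.
have [d1 d10 H1] := Hg (e / 2 / (cabs l + 1)) (divr_gt0 (divr_gt0 e0 (ltr0Sn _ 1)) L0).
(* The cap 1 makes [f] Lipschitz at [z] with constant [cabs l + 1]; the other term makes the inner
   remainder, multiplied by [m], cost at most half of [e]. *)
pose e2 := Num.min 1 (e / 2 / (cabs m + 1)).
have e20 : 0 < e2 by rewrite lt_min ltr01 !divr_gt0.
have [d2 d20 H2] := Hf e2 e20.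
exists (Num.min d2 (d1 / (cabs l + 1))); first by rewrite lt_min d20 divr_gt0.
move=> u; rewrite lt_min => /andP[u2 u1]; have {H2} := H2 u u2.
set k := f (z + u) - f z => H2; have u0 := cabs_ge0 u.
have e2m : cabs m * e2 <= e / 2.
  have : e2 <= e / 2 / (cabs m + 1) by rewrite ge_min lexx orbT.
  rewrite ler_pdivlMr// => h; apply: le_trans h; rewrite mulrC ler_wpM2l ?(ltW e20)// lerDl//.
have e21 : e2 <= 1 by rewrite ge_min lexx.
have Hk : cabs k <= (cabs l + 1) * cabs u.
  rewrite -[k](subrK (l * u)); apply: (le_trans (cabsD _ _)).
  rewrite cabsM mulrDl addrC lerD2l; apply: (le_trans H2).
  by rewrite ler_wpM2r.
have kd : cabs k < d1.
  by apply: le_lt_trans Hk _; rewrite mulrC -ltr_pdivlMr.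
have := H1 k kd; rewrite /k subrKC -/k => H3.
rewrite /= (_ : _ - _ - _ = (g (f (z + u)) - g (f z) - m * k) + m * (k - l * u)); last by ring.
apply: (le_trans (cabsD _ _)); rewrite [X in _ <= X](_ : _ = e / 2 * cabs u + e / 2 * cabs u); last first.
  by field.
apply: lerD.
  apply: (le_trans H3); rewrite -mulrA ler_wpM2l ?divr_ge0 ?(ltW e0)//.
  by rewrite ler_pdivrMl.
rewrite cabsM; apply: (le_trans (ler_wpM2l m0 H2)).
by rewrite mulrA ler_wpM2r.
Qed.

Lemma cdiffM (f g : C -> C) z l m : cdiff f z l -> cdiff g z m ->
  cdiff (fun z => f z * g z) z (f z * m + g z * l).
Proof.
move=> Hf Hg e e0.
have l0 := cabs_ge0 l; have m0 := cabs_ge0 m.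
have f0 := cabs_ge0 (f z); have g0 := cabs_ge0 (g z).
(* The coefficients of the three errors: the two linear remainders, and the product of the
   increments, in which one factor [cabs u] is below [r]. *)
pose S := cabs (f z) + cabs (g z) + (cabs l + 1) * (cabs m + 1) + 1.
have LM0 : 0 <= (cabs l + 1) * (cabs m + 1) by rewrite mulr_ge0 ?addr_ge0.
have S0 : 0 < S by rewrite /S ltr_wpDl// !addr_ge0.
pose r := Num.min 1 (e / S).
have r0 : 0 < r by rewrite lt_min ltr01 divr_gt0.
have r1 : r <= 1 by rewrite ge_min lexx.
have rS : S * r <= e by rewrite mulrC -ler_pdivlMr// ge_min lexx orbT.
clearbody r; have [d1 d10 H1] := Hf _ r0; have [d2 d20 H2] := Hg _ r0.
exists (Num.min r (Num.min d1 d2)); first by rewrite !lt_min r0 d10.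
move=> u; rewrite !lt_min => /and3P[ur u1 u2].
have u0 := cabs_ge0 u.
have {}H1 := H1 u u1; have {}H2 := H2 u u2.
have Hk (h : C -> C) (n : C) : cabs (h (z + u) - h z - n * u) <= r * cabs u ->
    cabs (h (z + u) - h z) <= (cabs n + 1) * cabs u.
  move=> H; rewrite -[h (z + u) - h z](subrK (n * u)); apply: (le_trans (cabsD _ _)).
  rewrite cabsM mulrDl addrC lerD2l; apply: (le_trans H).
  by rewrite ler_wpM2r.
have K1 := Hk _ _ H1; have K2 := Hk _ _ H2.
rewrite (_ : _ - _ - _ = f z * (g (z + u) - g z - m * u) + g z * (f (z + u) - f z - l * u)
  + (f (z + u) - f z) * (g (z + u) - g z)); last by ring.
apply: (le_trans (cabsD _ _)).
apply: (@le_trans _ _ ((cabs (f z) + cabs (g z)) * (r * cabs u) +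
   (cabs l + 1) * (cabs m + 1) * (r * cabs u))).
  apply: lerD.
    apply: (le_trans (cabsD _ _)); rewrite !cabsM mulrDl.
    by apply: lerD; apply: ler_wpM2l.
  rewrite cabsM; apply: (le_trans (ler_pM (cabs_ge0 _) (cabs_ge0 _) K1 K2)).
  rewrite mulrACA ler_wpM2l// ler_wpM2r// ltW//.
rewrite -mulrDl; apply: (@le_trans _ _ (S * (r * cabs u))).
  by rewrite ler_wpM2r ?mulr_ge0 ?(ltW r0)// /S lerDl.
by rewrite mulrA ler_wpM2r.
Qed.

Lemma cdiff_linear (a z : C) : cdiff (fun z => a * z) z a.
Proof.
move=> e e0; exists 1 => // u _.
rewrite (_ : _ - _ - _ = 0); last by ring.
by rewrite {1}/cabs/= expr0n/= addr0 sqrtr0 mulr_ge0 ?(ltW e0) ?cabs_ge0.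
Qed.

Lemma derivable_gauss z : derivable (gauss : C^o -> C^o) z 1.
Proof.
have H := cdiffM (cdiff_linear (-1) z) (cdiff_linear 1 z).
have := cdiff_comp H (cdiff_cexp _); rewrite /comp.
rewrite (_ : (fun x => _) = gauss); last first.
  by apply/funext => x; rewrite /gauss; congr cexp; ring.
exact: cdiff_derivable.
Qed.

Lemma cdiff_mul_cexp (f : C -> C) (a z l : C) : cdiff f z l ->
  exists l', cdiff (fun z => f z * cexp (a * z)) z l'.
Proof.
by move=> Hf; eexists; apply: (cdiffM Hf (cdiff_comp (cdiff_linear a z) (cdiff_cexp _))).
Qed.

End ComplexDerivative.

(** * Square integrability and the norm of L2 *)

Section SquareIntegrable.
Context {R : realType}.
Local Notation mu := (@lebesgue_measure R).
Implicit Types (h : R -> R).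

Lemma Lnorm2_fin h : measurable_fun setT h ->
  (Lnorm mu 2%:E (EFin \o h) < +oo)%E <-> Rintegrable (fun x => h x ^+ 2).
Proof.
move=> mh.
have m2 : measurable_fun setT (fun x => h x ^+ 2) by exact: measurable_funX.
have E : (\int[mu]_x (`|h x ^+ 2|)%:E = (Lnorm mu 2%:E (EFin \o h)) `^ 2)%E.
  rewrite powR_Lnorm ?pnatr_eq0//; apply: eq_integral => x _ /=.
  by rewrite ?poweR_EFin powR_mulrn// normrX.
have N0 := Lnorm_ge0 mu 2%:E (EFin \o h).
split=> H.
  apply/integrableP; split; first exact/measurable_EFinP.
  rewrite /comp /= E; move: N0 H; case: (Lnorm _ _ _) => [r| |]//= _ _.
  by rewrite ?poweR_EFin ltry.
have /integrableP[_] := H; rewrite /comp /= E; move: N0; case: (Lnorm _ _ _) => [r| |]//= _; first by move=> _; rewrite ltry.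
by rewrite ?poweRyr ?pnatr_eq0.
Qed.

End SquareIntegrable.

(** * The weighted space and linearity of W *)

Section WeightedL2.
Context {R : realType}.
Local Notation mu := (@lebesgue_measure R).
Local Notation C := R[i].
Variables (v : R -> R) (w : R).
Hypotheses (w0 : 0 <= w) (sv : strongly_admissible v).
Implicit Types (g : R -> C) (F G : C -> C).

Let wt g (s : R) : R := v s * expR (w * `|s|) * cabs (g s).

Definition inL2w g := cmeasurable g /\ Rintegrable (fun s => wt g s ^+ 2).

Let v1 s : 1 <= v s. Proof. by case: sv => [[]]. Qed.

Let mv : measurable_fun setT v. Proof. by case: sv => [[]]. Qed.

Lemma measurable_cabs g : cmeasurable g -> measurable_fun setT (fun s => cabs (g s)).
Proof.
move=> [m1 m2]; apply: (@measurableT_comp _ _ _ _ _ _ (@Num.sqrt R)).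
  by apply: continuous_measurable_fun => x; exact: sqrt_continuous.
by apply: measurable_funD; exact: measurable_funX.
Qed.

Lemma measurable_wt g : cmeasurable g -> measurable_fun setT (wt g).
Proof.
move=> mg; apply: measurable_funM; last exact: measurable_cabs.
apply: measurable_funM; first exact: mv.
apply: continuous_measurable_fun => s; apply: continuous_comp; last exact: continuous_expR.
by apply: cvgM; [exact: cvg_cst|exact: norm_continuous].
Qed.

Lemma wL2norm_fin g : cmeasurable g -> (wL2norm v w g < +oo)%E <-> Rintegrable (fun s => wt g s ^+ 2).
Proof. by move=> mg; apply: Lnorm2_fin; exact: measurable_wt. Qed.

Lemma inWP F : inW v w F <-> exists2 g, inL2w g & forall z, strip w z -> F z = fourier g z.
Proof.
split=> [[g [mg /(wL2norm_fin mg) ng Fg]]|[g [mg ng] Fg]].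
  by exists g.
by exists g; split=> //; apply/(wL2norm_fin mg).
Qed.

Lemma strip_Im z : strip w z -> `|imC z| <= w.
Proof.
by rewrite /strip; case: ifPn => [/eqP -> /= ->|_ /= /ltW//]; rewrite normr0.
Qed.

Lemma cmeasurable_mul g1 g2 : cmeasurable g1 -> cmeasurable g2 ->
  cmeasurable (fun s => g1 s * g2 s).
Proof.
move=> [a1 b1] [a2 b2]; split.
  rewrite (_ : (fun s => _) = (fun s => reC (g1 s) * reC (g2 s) - imC (g1 s) * imC (g2 s))).
    by apply: measurable_funB; apply: measurable_funM.
  by apply/funext => s; case: (g1 s) (g2 s) => [? ?] [].
rewrite (_ : (fun s => _) = (fun s => reC (g1 s) * imC (g2 s) + imC (g1 s) * reC (g2 s))).
  by apply: measurable_funD; apply: measurable_funM.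
by apply/funext => s; case: (g1 s) (g2 s) => [? ?] [].
Qed.

Lemma fourier_exponent (s x y : R) :
  - ('i * (rC s * Complex x y)) = Complex (s * y) (- (s * x)).
Proof. by apply/eqP; rewrite eq_complex /rC/=; apply/andP; split; apply/eqP; ring. Qed.

Lemma cmeasurable_wave (z : C) : cmeasurable (fun s => cexp (- ('i * (rC s * z)))).
Proof.
case: z => x y.
have cM (r : R) : continuous (fun s : R => s * r).
  by move=> s; apply: cvgM; [exact: cvg_id|exact: cvg_cst].
split; under eq_fun do rewrite fourier_exponent /cexp /=; apply: continuous_measurable_fun => s;
  apply: cvgM; apply: continuous_comp; try exact: cM; try exact: continuous_expR;
  try (apply: cvgN; exact: cM); try exact: continuous_cos; exact: continuous_sin.
Qed.

Definition cintegrable (h : R -> C) :=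
  Rintegrable (fun s => reC (h s)) /\ Rintegrable (fun s => imC (h s)).

(** On the strip [|exp(-isz)| <= exp(w|s|)], so the integrand is at most the weighted [|g|] times
    [1/v], hence at most the sum of their squares. Strong admissibility makes the second square
    integrable. *)
Lemma inL2w_fourier_integrable g z : inL2w g -> strip w z ->
  cintegrable (fun s => g s * cexp (- ('i * (rC s * z)))).
Proof.
move=> [mg ng] /strip_Im sz.
have [_ V2] := sv.
have mvV : measurable_fun setT (fun s => (v s)^-1).
  have -> : (fun s => (v s)^-1) = (fun s => v s `^ (-1)).
    by apply/funext => s; rewrite powR_inv1// (le_trans _ (v1 s)).
  exact: (measurableT_comp (@measurable_powR R (-1)) mv).
have {}V2 : Rintegrable (fun s => (v s)^-1 ^+ 2) by apply/Lnorm2_fin.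
have [mr mi] := cmeasurable_mul mg (cmeasurable_wave z).
have dom s : cabs (g s * cexp (- ('i * (rC s * z)))) <= wt g s ^+ 2 + (v s)^-1 ^+ 2.
  rewrite cabsM cabs_cexp.
  have hE : expR (reC (- ('i * (rC s * z)))) <= expR (w * `|s|).
    rewrite ler_expR; move: sz; case: z {mr mi} => x y; rewrite fourier_exponent /= => sz.
    rewrite (le_trans (ler_norm _))// normrM mulrC ler_wpM2r//.
  have c0 := cabs_ge0 (g s).
  have h1 : cabs (g s) * expR (reC (- ('i * (rC s * z)))) <= wt g s * (v s)^-1.
    rewrite /wt [_ * (v s)^-1]mulrC -mulrA mulKf ?gt_eqF ?(lt_le_trans _ (v1 s))//.
    by rewrite mulrC ler_wpM2r.
  apply: (le_trans h1).
  have := sqr_ge0 (wt g s - (v s)^-1).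
  have := sqr_ge0 (wt g s); have := sqr_ge0 (v s)^-1; nra.
have I2 : Rintegrable (fun s => wt g s ^+ 2 + (v s)^-1 ^+ 2).
  exact: (integrableD measurableT ng V2).
split; apply: (Rintegrable_le _ I2) => // s; apply: le_trans (dom s).
  exact: ler_Re_cabs.
exact: ler_Im_cabs.
Qed.

Lemma cintegralD h1 h2 : cintegrable h1 -> cintegrable h2 ->
  cintegral (fun s => h1 s + h2 s) = cintegral h1 + cintegral h2.
Proof.
move=> [r1 i1] [r2 i2]; rewrite /cintegral; apply/eqP; rewrite eq_complex/=.
rewrite -!RintegralD//; apply/andP; split; apply/eqP; apply: eq_Rintegral => s _;
  by case: (h1 s) (h2 s) => [? ?] [].
Qed.

Lemma cintegralZ (a : C) h : cintegrable h ->
  cintegral (fun s => a * h s) = a * cintegral h.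
Proof.
case: a => a b [r i].
have Ere : \int[mu]_s reC (Complex a b * h s) =
    a * \int[mu]_s reC (h s) - b * \int[mu]_s imC (h s).
  rewrite -(RintegralZl a measurableT r) -(RintegralZl b measurableT i).
  rewrite -(RintegralB measurableT (RintegrableZl a r) (RintegrableZl b i)).
  by apply: eq_Rintegral => s _; case: (h s).
have Eim : \int[mu]_s imC (Complex a b * h s) =
    a * \int[mu]_s imC (h s) + b * \int[mu]_s reC (h s).
  rewrite -(RintegralZl a measurableT i) -(RintegralZl b measurableT r).
  rewrite -(RintegralD measurableT (RintegrableZl a i) (RintegrableZl b r)).
  by apply: eq_Rintegral => s _; case: (h s).
by rewrite /cintegral Ere Eim.
Qed.

Lemma inL2wD g1 g2 : inL2w g1 -> inL2w g2 -> inL2w (fun s => g1 s + g2 s).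
Proof.
move=> [m1 n1] [m2 n2].
have m12 : cmeasurable (fun s => g1 s + g2 s).
  case: m1 m2 => [a1 b1] [a2 b2]; split.
    rewrite (_ : (fun s => _) = (fun s => reC (g1 s) + reC (g2 s))); first exact: measurable_funD.
    by apply/funext => s; case: (g1 s) (g2 s) => [? ?] [].
  rewrite (_ : (fun s => _) = (fun s => imC (g1 s) + imC (g2 s))); first exact: measurable_funD.
  by apply/funext => s; case: (g1 s) (g2 s) => [? ?] [].
split=> //.
have I2 : Rintegrable (fun s => 2 * wt g1 s ^+ 2 + 2 * wt g2 s ^+ 2).
  exact: (integrableD measurableT (RintegrableZl 2 n1) (RintegrableZl 2 n2)).
apply: (Rintegrable_le _ I2) => [|s].
  by apply: measurable_funX; exact: measurable_wt.
rewrite ger0_norm ?sqr_ge0//.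
have ve : 0 <= v s * expR (w * `|s|) by rewrite mulr_ge0 ?expR_ge0// (le_trans _ (v1 s)).
have h : wt (fun s => g1 s + g2 s) s <= wt g1 s + wt g2 s.
  by rewrite /wt -mulrDr ler_wpM2l// cabsD.
have p : 0 <= wt (fun s => g1 s + g2 s) s by rewrite /wt mulr_ge0// cabs_ge0.
have := sqr_ge0 (wt g1 s - wt g2 s).
move: h p; set A := wt _ s; set B := wt g1 s; set D := wt g2 s; nra.
Qed.

Lemma inL2wZ (a : C) g : inL2w g -> inL2w (fun s => a * g s).
Proof.
move=> [mg ng].
have ma : cmeasurable (fun s : R => a) by split; exact: measurable_cst.
have m2 := cmeasurable_mul ma mg.
split=> //; apply: (Rintegrable_le _ (RintegrableZl (cabs a ^+ 2) ng)) => [|s].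
  by apply: measurable_funX; exact: measurable_wt.
by rewrite ger0_norm ?sqr_ge0// /wt cabsM mulrCA exprMn.
Qed.

Lemma inWD F G : inW v w F -> inW v w G -> inW v w (fun z => F z + G z).
Proof.
move=> /inWP[f Lf Ff] /inWP[g Lg Gg]; apply/inWP; exists (fun s => f s + g s).
  exact: inL2wD.
move=> z sz; rewrite Ff// Gg// /fourier -cintegralD; try exact: inL2w_fourier_integrable.
by congr cintegral; apply/funext => s; rewrite mulrDl.
Qed.

Lemma inWZ (a : C) F : inW v w F -> inW v w (fun z => a * F z).
Proof.
move=> /inWP[f Lf Ff]; apply/inWP; exists (fun s => a * f s); first exact: inL2wZ.
move=> z sz; rewrite Ff// /fourier -cintegralZ; last exact: inL2w_fourier_integrable.
by congr cintegral; apply/funext => s; rewrite mulrA.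
Qed.

Lemma inWB F G : inW v w F -> inW v w G -> inW v w (fun z => F z - G z).
Proof.
move=> hF hG; rewrite (_ : (fun z => _) = (fun z => F z + (-1) * G z)).
  by apply: inWD => //; exact: inWZ.
by apply/funext => z; rewrite mulN1r.
Qed.

Lemma Wnorm_inW F : (Wnorm v w F < +oo)%E -> inW v w F.
Proof.
by move=> /ereal_inf_lt[_ [g hg _] _]; exists g.
Qed.

End WeightedL2.

(** * Real-valued norm, bounded operators and strong limits *)

Lemma four_quarters (R : realFieldType) (e : R) : e / 4 + e / 4 + (e / 4 + e / 4) = e.
Proof. by lra. Qed.

Section RealNorm.
Context {R : realType} {X : completeNormedModType R[i]}.
Implicit Types (x y : X) (u : nat -> X).

(** The norm of [X] takes values in [R[i]]; its real part carries it and allows real estimates. *)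
Definition rnorm x : R := reC `|x|.

Lemma normr_rnorm x : `|x| = rC (rnorm x).
Proof.
rewrite /rnorm /rC; have := normr_ge0 x; case: `|x| => a b /=.
by rewrite lecE /= => /andP[/eqP -> _].
Qed.

Lemma gt0_rC (e : R[i]) : 0 < e -> e = rC (reC e) /\ 0 < reC e.
Proof. by case: e => a b; rewrite ltcE/= => /andP[/eqP -> h]. Qed.

Lemma rnorm_ge0 x : 0 <= rnorm x.
Proof. by rewrite -lerC -normr_rnorm normr_ge0. Qed.

Lemma rnormD x y : rnorm (x + y) <= rnorm x + rnorm y.
Proof. by rewrite -lerC rC_add -!normr_rnorm ler_normD. Qed.

Lemma rnormN x : rnorm (- x) = rnorm x.
Proof. by rewrite /rnorm normrN. Qed.

Lemma rnormB x y : rnorm (x - y) <= rnorm x + rnorm y.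
Proof. by rewrite -(rnormN y) rnormD. Qed.

Lemma rnorm_eq0 x : rnorm x <= 0 -> x = 0.
Proof.
move=> h; apply/eqP; rewrite -normr_le0 normr_rnorm -[X in _ <= X]/(rC 0).
by rewrite lerC.
Qed.

Definition rcvg u (l : X) := forall e : R, 0 < e -> exists N, forall n, (N <= n)%N ->
  rnorm (u n - l) <= e.

Lemma rcvgP u l : rcvg u l <-> u @ \oo --> l.
Proof.
split=> [H|/cvgrPdist_le H].
  apply/cvgrPdist_le => e /gt0_rC[-> e0]; have [N HN] := H _ e0.
  exists N => // n /= Nn; rewrite distrC normr_rnorm lerC; exact: HN.
move=> e e0; have [|N _ HN] := H (rC e); first by rewrite -[0]/(rC 0) ltrC.
by exists N => n Nn; rewrite -lerC -normr_rnorm distrC; exact: HN.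
Qed.

Lemma rcauchy_cvg u : (forall e : R, 0 < e -> exists N, forall n m, (N <= n)%N ->
  (N <= m)%N -> rnorm (u n - u m) <= e) -> exists l, rcvg u l.
Proof.
move=> H; suff : cvgn u by move=> cu; exists (limn u); apply/rcvgP.
apply: cauchy_cvg; apply/cauchy_exP => e /gt0_rC[-> e0].
have [N HN] := H _ (divr_gt0 e0 (ltr0Sn _ 1)).
exists (u N), N => // n /= Nn; rewrite -ball_normE /ball_/= normr_rnorm ltrC.
apply: (le_lt_trans (HN N n _ _)) => //.
by rewrite ltr_pdivrMr// ltr_pMr// ltr1n.
Qed.

Lemma rcvg_lin (a : R[i]) u v l l' : rcvg u l -> rcvg v l' ->
  rcvg (fun n => a *: u n + v n) (a *: l + l').
Proof.
move=> /rcvgP h /rcvgP h'; apply/rcvgP; apply: cvgD => //.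
by apply: cvgZ => //; exact: cvg_cst.
Qed.

Lemma bounded_op_linear (T : X -> X) : bounded_op T -> forall a x y,
  T (a *: x + y) = a *: T x + T y.
Proof. by case=> l _ a x y; exact: l. Qed.

Lemma bounded_op0 (T : X -> X) : bounded_op T -> T 0 = 0.
Proof.
move=> /bounded_op_linear H; have := H (-1) 0 0.
by rewrite scaler0 addr0 scaleN1r addNr.
Qed.

Lemma bounded_opB (T : X -> X) : bounded_op T -> {morph T : x y / x - y}.
Proof.
move=> bT x y; have H := bounded_op_linear bT.
by rewrite addrC -scaleN1r H scaleN1r addrC.
Qed.

Lemma bounded_op_rnorm (T : X -> X) : bounded_op T ->
  exists2 M : R, 0 < M & forall x, rnorm (T x) <= M * rnorm x.
Proof.
case=> _ [M HM]; exists (`|M| + 1); first by rewrite ltr_wpDl.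
move=> x; have := HM x; rewrite !normr_rnorm -rC_mul lerC => h; apply: (le_trans h).
by rewrite ler_wpM2r ?rnorm_ge0// (le_trans (ler_norm M))// lerDl.
Qed.

(* The set of vectors on which [T n] converges to the value prescribed by
   [C = B^-1 S] is a closed subspace. *)
Lemma strong_limit (T : nat -> X -> X) (M : R) (B S : X -> X) (G : set X) :
  (forall n, bounded_op (T n)) -> (forall n x, rnorm (T n x) <= M * rnorm x) ->
  bounded_op B -> (forall x, B x = 0 -> x = 0) -> bounded_op S ->
  (forall x, G x -> exists2 l, rcvg (T^~ x) l & B l = S x) ->
  closure [set x | exists (n : nat) (a : 'I_n -> R[i]) (y : 'I_n -> X),
     (forall i, G (y i)) /\ x = \sum_(i < n) a i *: y i] = setT ->
  exists2 C : X -> X, bounded_op C & forall x, rcvg (T^~ x) (C x) /\ B (C x) = S x.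
Proof.
move=> bT TM bB injB bS GT dG.
pose good x := exists2 l, rcvg (T^~ x) l & B l = S x.
have good_lin a x y : good x -> good y -> good (a *: x + y).
  move=> [l hl El] [l' hl' El']; exists (a *: l + l').
    move=> e e0; have [N HN] := rcvg_lin a hl hl' e0; exists N => n Nn.
    by rewrite (bounded_op_linear (bT n)); exact: HN.
  by rewrite (bounded_op_linear bB) (bounded_op_linear bS) El El'.
have good0 : good 0.
  exists 0; last by rewrite (bounded_op0 bB) (bounded_op0 bS).
  by move=> e e0; exists 0%N => n _; rewrite (bounded_op0 (bT n)) subr0 /rnorm normr0 ltW.
have good_sum n (a : 'I_n -> R[i]) (y : 'I_n -> X) : (forall i, G (y i)) ->
    good (\sum_(i < n) a i *: y i).
  elim: n a y => [|n IH] a y Gy; first by rewrite big_ord0.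
  rewrite big_ord_recl; apply: good_lin; first exact: GT.
  by apply: IH => i; exact: Gy.
(* A strictly positive bound, since [M] may be 0 or negative and is divided by below. *)
pose M' := `|M| + 1.
have M'0 : 0 < M' by rewrite /M' ltr_wpDl.
have TM' n x : rnorm (T n x) <= M' * rnorm x.
  rewrite (le_trans (TM n x))// ler_wpM2r ?rnorm_ge0//.
  by rewrite (le_trans (ler_norm M))// lerDl.
have approx x (e : R) : 0 < e -> exists2 d, good d & rnorm (x - d) < e.
  move=> e0; have : closure [set x | exists (n : nat) (a : 'I_n -> R[i]) (y : 'I_n -> X),
     (forall i, G (y i)) /\ x = \sum_(i < n) a i *: y i] x by rewrite dG.
  have re0 : 0 < rC e by rewrite -[0]/(rC 0) ltrC.
  move=> /(_ _ (nbhsx_ballx x (rC e) re0))[d [[n [a [y [Gy ->]]]] hd]].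
  exists (\sum_(i < n) a i *: y i); first exact: good_sum.
  by move: hd; rewrite -ball_normE /ball_/= normr_rnorm ltrC.
have lim_bound x l : rcvg (T^~ x) l -> rnorm l <= M' * rnorm x.
  move=> h; apply/ler_addgt0Pl => e e0; have [N HN] := h e e0.
  rewrite -[l](subKr (T N x)); apply: (le_trans (rnormB _ _)).
  by rewrite addrC; apply: lerD; [exact: HN|exact: TM'].
have [MB MB0 HB] := bounded_op_rnorm bB.
have [MS MS0 HS] := bounded_op_rnorm bS.
have all_good x : good x.
  have [l hl] : exists l, rcvg (T^~ x) l.
    apply: rcauchy_cvg => e e0.
    (* Four errors of [e / 4]: two from replacing [x] by [d], two from convergence at [d]. *)
    have [d [ld hd _] xd] := approx x (e / (4 * M')) (divr_gt0 e0 (mulr_gt0 (ltr0Sn _ 3) M'0)).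
    have [N HN] := hd _ (divr_gt0 e0 (ltr0Sn _ 3)).
    exists N => n m /HN h1 /HN h2.
    rewrite (_ : T n x - T m x = T n (x - d) + (T n d - ld) - (T m (x - d) + (T m d - ld))); last first.
      rewrite (bounded_opB (bT n)) (bounded_opB (bT m)).
      by rewrite !addrA !subrK opprB addrA subrK.
    apply: (le_trans (rnormB _ _)).
    have h3 := rnormD (T n (x - d)) (T n d - ld).
    have h4 := rnormD (T m (x - d)) (T m d - ld).
    have h5 := TM' n (x - d); have h6 := TM' m (x - d).
    have h7 : M' * rnorm (x - d) <= e / 4.
      by move: (ltW xd); rewrite invfM mulrA ler_pdivlMr// mulrC.
    rewrite (le_trans (lerD (le_trans h3 (lerD (le_trans h5 h7) h1)) (le_trans h4 (lerD (le_trans h6 h7) h2))))//.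
    by rewrite four_quarters.
  exists l => //; apply/eqP; rewrite -subr_eq0; apply/eqP; apply: rnorm_eq0.
  apply/ler_addgt0Pl => e e0; rewrite addr0.
  (* As [B ld = S d], the defect [B l - S x] is [B (l - ld) - S (x - d)]; and [l - ld] is the limit
     of [T n (x - d)], hence at most [M'] times [rnorm (x - d)]. *)
  have K0 : 0 < MB * M' + MS by rewrite addr_gt0// mulr_gt0.
  have [d [ld hd Ed] xd] := approx x _ (divr_gt0 e0 K0).
  rewrite (_ : B l - S x = B (l - ld) - S (x - d)); last first.
    by rewrite (bounded_opB bB) (bounded_opB bS) Ed opprB addrA subrK.
  have h1 := rnormB (B (l - ld)) (S (x - d)).
  have h2 := HB (l - ld); have h3 := HS (x - d).
  have h4 : rnorm (l - ld) <= M' * rnorm (x - d).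
    apply: lim_bound => e' e'0; have [N HN] := rcvg_lin (- 1) hd hl e'0.
    exists N => n /HN; rewrite !scaleN1r (bounded_opB (bT n)).
    by rewrite [- T n d + _]addrC [- ld + _]addrC.
  have h5 : MB * rnorm (l - ld) <= MB * (M' * rnorm (x - d)) by rewrite ler_wpM2l// ltW.
  have h6 : (MB * M' + MS) * rnorm (x - d) <= e.
    by move: (ltW xd); rewrite ler_pdivlMr// mulrC.
  apply: (le_trans h1); apply: (le_trans (lerD (le_trans h2 h5) h3)).
  by rewrite mulrA -mulrDl.
have /choice[C HC] : forall x, exists l, rcvg (T^~ x) l /\ B l = S x.
  by move=> x; have [l h1 h2] := all_good x; exists l.
exists C => //; split; last first.
  exists M' => x; rewrite !normr_rnorm -rC_mul lerC; apply: lim_bound.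
  by have [] := HC x.
(* Linearity of [C] follows from [B C = S], [B] being linear and injective. *)
move=> a x y; apply/eqP; rewrite -subr_eq0; apply/eqP/injB.
rewrite (bounded_opB bB) (bounded_op_linear bB).
have -> := (HC x).2; have -> := (HC y).2; have -> := (HC (a *: x + y)).2.
by rewrite (bounded_op_linear bS) subrr.
Qed.

End RealNorm.

(** * Rapidly decreasing holomorphic functions belong to W *)

Section HolomorphicDecay.
Context {R : realType}.
Local Notation mu := (@lebesgue_measure R).
Local Notation C := R[i].
Variables (psi : C -> C) (w th : R).
Hypotheses (w0 : 0 <= w) (wth : w < th) (Hpsi : inH0 th psi).

Let beta : R := (w + th) / 2.

Let beta_w : w < beta.
Proof. by rewrite /beta ltr_pdivlMr// mulr_natr mulr2n ltrD2l. Qed.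

Let beta_th : beta < th.
Proof. by rewrite /beta ltr_pdivrMr// mulr_natr mulr2n ltrD2r. Qed.

Let beta0 : 0 < beta. Proof. exact: le_lt_trans beta_w. Qed.

Let in_strip z : `|imC z| <= beta -> strip th z.
Proof.
move=> h; rewrite /strip ifN ?gt_eqF//=; last exact: (lt_trans beta0).
exact: le_lt_trans beta_th.
Qed.

Let psi_decay : exists2 K : R, 0 <= K & forall z, `|imC z| <= beta ->
  cabs (psi z) <= K * decay (reC z).
Proof.
have [_ /(_ 2 (ltr0Sn _ 1))[K HK]] := Hpsi; exists `|K| => // z hz.
apply: (le_trans (HK z (in_strip hz))).
have n0 : 0 <= 1 + `|reC z| by rewrite addr_ge0.
rewrite powRN powR_mulrn// -/(decay _).
by rewrite ler_wpM2r ?(ltW (decay_gt0 _))// ler_norm.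
Qed.

Let psi_cdiff z : `|imC z| <= beta -> exists l, cdiff psi z l.
Proof. by move=> hz; apply: derivable_cdiff; have [H _] := Hpsi; apply: H; exact: in_strip. Qed.

(** The integrand [psi(z) exp(isz)] of the inverse Fourier integral; [U] and [V] are its real and
    imaginary parts. *)
Let h (s : R) z : C := psi z * cexp (Complex 0 s * z).
Let A (y x : R) : R := reC (psi (Complex x y)).
Let B (y x : R) : R := imC (psi (Complex x y)).
Let U s (x y : R) : R := reC (h s (Complex x y)).
Let V s (x y : R) : R := imC (h s (Complex x y)).

Let UE s x y : U s x y = expR (- (s * y)) * (A y x * cos (s * x) - B y x * sin (s * x)).
Proof.
rewrite /U /h /A /B; case: (psi _) => p q; rewrite /cexp /reC /imC /=.
by rewrite !mul0r sub0r add0r; ring.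
Qed.

Let VE s x y : V s x y = expR (- (s * y)) * (A y x * sin (s * x) + B y x * cos (s * x)).
Proof.
rewrite /V /h /A /B; case: (psi _) => p q; rewrite /cexp /reC /imC /=.
by rewrite !mul0r sub0r add0r; ring.
Qed.

Let cabs_h s x y : cabs (h s (Complex x y)) = cabs (psi (Complex x y)) * expR (- (s * y)).
Proof. by rewrite /h cabsM cabs_cexp /= mul0r sub0r. Qed.

Let continuousA y : `|y| <= beta -> continuous (A y).
Proof.
by move=> hy x; have [l /cdiff_diff2[/diff2_continuous1]] := @psi_cdiff (Complex x y) hy.
Qed.

Let continuousB y : `|y| <= beta -> continuous (B y).
Proof.
by move=> hy x; have [l /cdiff_diff2[_ /diff2_continuous1]] := @psi_cdiff (Complex x y) hy.
Qed.

Let diff2_h s x y : `|y| <= beta -> exists p q, diff2 (U s) x y p (- q) /\ diff2 (V s) x y q p.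
Proof.
move=> hy; have [l Hl] := @psi_cdiff (Complex x y) hy.
have [l' /cdiff_diff2[h1 h2]] := cdiff_mul_cexp (Complex 0 s) Hl.
by exists (reC l'), (imC l').
Qed.

Let diff2N (F : R -> R -> R) x y p q : diff2 F x y p q ->
  diff2 (fun x y => - F x y) x y (- p) (- q).
Proof.
move=> H e e0; have [d d0 Hd] := H e e0; exists d => // x' y' hx hy.
rewrite -normrN; apply: le_trans (Hd x' y' hx hy); rewrite le_eqVlt; apply/orP; left.
by apply/eqP; congr `|_|; ring.
Qed.

Let exp_bound s y : `|y| <= beta -> expR (- (s * y)) <= expR (beta * `|s|).
Proof.
move=> hy; rewrite ler_expR (le_trans (ler_norm _))// normrN normrM mulrC.
by rewrite ler_wpM2r.
Qed.

Let Udecay K s x y : (forall z, `|imC z| <= beta -> cabs (psi z) <= K * decay (reC z)) ->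
  `|y| <= beta -> `|U s x y| <= expR (- (s * y)) * K * decay x /\
    `|V s x y| <= expR (- (s * y)) * K * decay x.
Proof.
move=> HK hy; have H : cabs (h s (Complex x y)) <= expR (- (s * y)) * K * decay x.
  rewrite cabs_h mulrC -mulrA ler_wpM2l ?expR_ge0//; exact: HK.
by split; [exact: le_trans (ler_Re_cabs _) H|exact: le_trans (ler_Im_cabs _) H].
Qed.

(** The real and imaginary parts of [h dz] are [U dx - V dy] and [V dx + U dy]; both are closed by
    Cauchy-Riemann, so [contour_shift] applies to each. *)
Let shift_UV s y1 y2 : `|y1| <= beta -> `|y2| <= beta ->
  \int[mu]_x U s x y1 = \int[mu]_x U s x y2 /\ \int[mu]_x V s x y1 = \int[mu]_x V s x y2.
Proof.
wlog y12 : y1 y2 / y1 <= y2 => [H h1 h2|].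
  have [y12|/ltW y21] := leP y1 y2; first exact: H.
  by have [-> ->] := H y2 y1 y21 h2 h1.
move=> h1 h2; have [K K0 HK] := psi_decay.
have mid y : y1 <= y <= y2 -> `|y| <= beta.
  move: h1 h2; rewrite !ler_norml => /andP[a1 a2] /andP[a3 a4] /andP[a5 a6].
  by rewrite (le_trans a1)//= (le_trans a6).
have bnd x y : y1 <= y <= y2 -> `|U s x y| <= expR (beta * `|s|) * K * decay x /\
    `|V s x y| <= expR (beta * `|s|) * K * decay x.
  move=> /mid hy; have [b1 b2] := Udecay s x HK hy.
  have := exp_bound s hy => he.
  have le : expR (- (s * y)) * K * decay x <= expR (beta * `|s|) * K * decay x.
    by rewrite ler_wpM2r ?(ltW (decay_gt0 _))// ler_wpM2r.
  by split; [exact: le_trans b1 le|exact: le_trans b2 le].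
split.
  apply: (@contour_shift R (U s) (fun x y => - V s x y) y1 y2 (expR (beta * `|s|) * K) y12).
  - move=> x y /mid hy; have [p [q [d1 d2]]] := diff2_h s x hy.
    by exists p, (- q), (- p); split=> //; exact: diff2N.
  - by move=> x y /(bnd x)[].
  - by move=> x y /(bnd x)[_]; rewrite normrN.
apply: (@contour_shift R (V s) (U s) y1 y2 (expR (beta * `|s|) * K) y12).
- move=> x y /mid hy; have [p [q [d1 d2]]] := diff2_h s x hy.
  by exists q, p, (- q).
- by move=> x y /(bnd x)[].
- by move=> x y /(bnd x)[].
Qed.

Let Iuv s y : `|y| <= beta -> Rintegrable (fun x => U s x y) /\ Rintegrable (fun x => V s x y).
Proof.
move=> hy; have [K K0 HK] := psi_decay.
have ID : Rintegrable (fun x : R => expR (- (s * y)) * K * decay x).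
  exact/RintegrableZl/Rintegrable_decay.
split; apply: (Rintegrable_le _ ID) => [|x].
- apply: continuous_measurable_fun => x.
  by have [p [q [/diff2_continuous1]]] := diff2_h s x hy.
- by have [] := Udecay s x HK hy.
- apply: continuous_measurable_fun => x.
  by have [p [q [_ /diff2_continuous1]]] := diff2_h s x hy.
- by have [] := Udecay s x HK hy.
Qed.

Let UV_small : exists2 M, 0 <= M & forall s y, `|y| <= beta ->
  `|\int[mu]_x U s x y| <= M * expR (- (beta * `|s|)) /\
  `|\int[mu]_x V s x y| <= M * expR (- (beta * `|s|)).
Proof.
have [K K0 HK] := psi_decay.
exists (K * \int[mu]_x decay x).
  by rewrite mulr_ge0// Rintegral_ge0// => x _; exact/ltW/decay_gt0.
(* The line is moved to the side, chosen by the sign of [s], on which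
   [|exp(isz)| = exp(-beta|s|)]. *)
move=> s y hy; pose y' : R := if 0 <= s then beta else - beta.
have hy' : `|y'| <= beta by rewrite /y'; case: ifP; rewrite ?normrN gtr0_norm.
have sy' : s * y' = beta * `|s|.
  rewrite /y'; case: ifPn => [s0|]; first by rewrite ger0_norm// mulrC.
  by rewrite -ltNge => s0; rewrite ltr0_norm// mulrN mulrC mulrN.
have [-> ->] := shift_UV s hy hy'; have [IU IV] := Iuv s hy'.
have ID : Rintegrable (fun x : R => expR (- (s * y')) * K * decay x).
  exact/RintegrableZl/Rintegrable_decay.
have E : \int[mu]_x (expR (- (s * y')) * K * decay x) =
    K * \int[mu]_x decay x * expR (- (beta * `|s|)).
  by rewrite RintegralZl//; [rewrite sy'; ring|exact: Rintegrable_decay].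
split; rewrite -E.
  apply: (le_trans (le_normr_Rintegral measurableT IU)); apply: le_Rintegral => //.
    exact: (integrable_norm IU).
  by move=> x _; have [] := Udecay s x HK hy'.
apply: (le_trans (le_normr_Rintegral measurableT IV)); apply: le_Rintegral => //.
  exact: (integrable_norm IV).
by move=> x _; have [] := Udecay s x HK hy'.
Qed.

(** The real part of [exp(is(x - x0)) = exp(sy) exp(-isx0) exp(is(x + iy))], multiplied by
    [psi(x + iy)] and integrated in [x]. *)
Let wave_re s x0 y : `|y| <= beta ->
  \int[mu]_x (A y x * cos (s * (x - x0)) - B y x * sin (s * (x - x0))) =
  expR (s * y) * (cos (s * x0) * \int[mu]_x U s x y + sin (s * x0) * \int[mu]_x V s x y).
Proof.
move=> hy; have [IU IV] := Iuv s hy.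
rewrite -!RintegralZl// -RintegralD//; [|exact: RintegrableZl..].
rewrite -RintegralZl//; last exact: (integrableD measurableT (RintegrableZl _ IU) (RintegrableZl _ IV)).
apply: eq_Rintegral => x _; rewrite UE VE mulrBr cosB sinB.
have E : expR (s * y) * expR (- (s * y)) = 1 by rewrite -expRD subrr expR0.
move: E; set e1 := expR (s * y); set e2 := expR _ => E.
rewrite [RHS](_ : _ = (e1 * e2) * (cos (s * x0) * (A y x * cos (s * x) - B y x * sin (s * x)) +
  sin (s * x0) * (A y x * sin (s * x) + B y x * cos (s * x)))); last by ring.
by rewrite E; ring.
Qed.

Let wave_im s x0 y : `|y| <= beta ->
  \int[mu]_x (B y x * cos (s * (x - x0)) - (- A y x) * sin (s * (x - x0))) =
  expR (s * y) * (cos (s * x0) * \int[mu]_x V s x y - sin (s * x0) * \int[mu]_x U s x y).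
Proof.
move=> hy; have [IU IV] := Iuv s hy.
rewrite -!RintegralZl// -RintegralB//; [|exact: RintegrableZl..].
rewrite -RintegralZl//; last exact: (integrableB measurableT (RintegrableZl _ IV) (RintegrableZl _ IU)).
apply: eq_Rintegral => x _; rewrite UE VE mulrBr cosB sinB.
have E : expR (s * y) * expR (- (s * y)) = 1 by rewrite -expRD subrr expR0.
move: E; set e1 := expR (s * y); set e2 := expR _ => E.
rewrite [RHS](_ : _ = (e1 * e2) * (cos (s * x0) * (A y x * sin (s * x) + B y x * cos (s * x)) -
  sin (s * x0) * (A y x * cos (s * x) - B y x * sin (s * x)))); last by ring.
by rewrite E; ring.
Qed.

(** [kappa] is the factor [1/(2 pi)], and [g] the inverse Fourier transform of [psi] on the real
    line. *)
Let kappa : R := (@poisson_mass R)^-1.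
Let gr (s : R) : R := kappa * \int[mu]_x U s x 0.
Let gi (s : R) : R := kappa * \int[mu]_x V s x 0.
Let g (s : R) : C := Complex (gr s) (gi s).

Let n0 : `|0 : R| <= beta. Proof. by rewrite normr0 ltW. Qed.

Let decayAB : exists2 K, 0 <= K & forall y x, `|y| <= beta ->
  `|A y x| <= K * decay x /\ `|B y x| <= K * decay x.
Proof.
have [K K0 HK] := psi_decay; exists K => // y x hy.
have := HK (Complex x y) hy => H.
by split; [exact: le_trans (ler_Re_cabs _) H|exact: le_trans (ler_Im_cabs _) H].
Qed.

Let mg : cmeasurable g.
Proof.
have [K K0 HK] := decayAB.
have E1 s : gr s = kappa * \int[mu]_x (A 0 x * cos (s * (x - 0)) - B 0 x * sin (s * (x - 0))).
  by rewrite wave_re// !mulr0 sin0 cos0 expR0 !mul1r mul0r addr0.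
have E2 s : gi s = kappa * \int[mu]_x (B 0 x * cos (s * (x - 0)) - (- A 0 x) * sin (s * (x - 0))).
  by rewrite wave_im// !mulr0 sin0 cos0 expR0 !mul1r mul0r subr0.
split; rewrite /g /=.
  under eq_fun do rewrite E1.
  apply: measurable_funM; first exact: measurable_cst.
  apply: (@measurable_wave_integral R (A 0) (B 0) K 0 (continuousA n0) (continuousB n0)).
    by move=> x; have [] := HK 0 x n0.
  by move=> x; have [] := HK 0 x n0.
under eq_fun do rewrite E2.
apply: measurable_funM; first exact: measurable_cst.
apply: (@measurable_wave_integral R (B 0) (fun x => - A 0 x) K 0 (continuousB n0)).
- by move=> x; apply: cvgN; exact: continuousA.
- by move=> x; have [] := HK 0 x n0.
- by move=> x; rewrite normrN; have [] := HK 0 x n0.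
Qed.

Let kappa0 : 0 < kappa. Proof. by rewrite invr_gt0 poisson_mass_gt0. Qed.

Let g_small : exists2 M, 0 <= M & forall s, cabs (g s) <= M * expR (- (beta * `|s|)).
Proof.
have [M M0 HM] := UV_small; exists (kappa * M + kappa * M).
  by rewrite addr_ge0// mulr_ge0// ltW.
move=> s; apply: (le_trans (cabs_le _)) => /=; have [h1 h2] := HM s 0 n0.
rewrite mulrDl /gr /gi !normrM (gtr0_norm kappa0) -(mulrA kappa M).
by apply: lerD; apply: ler_wpM2l => //; exact: ltW kappa0.
Qed.

(** For [z = x0 + iy] the integrals defining [g] are shifted from the real line to height [y]. Then
    [g(s) exp(-isz)] is [kappa] times the wave integral of [psi] on that line centred at [x0], and
    Abel inversion returns [psi z]. *)
Let fourier_g z : strip w z -> psi z = fourier g z.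
Proof.
move=> /strip_Im; case: z => x0 y /= hyw.
have hy : `|y| <= beta by rewrite (le_trans hyw)// ltW.
have [K K0 HK] := decayAB.
have [M M0 HM] := UV_small.
have dl0 : 0 < beta - w by rewrite subr_gt0.
(* The factor [exp(sy)] costs at most [exp(w|s|)] against the decay [exp(-beta|s|)]; the margin
   [beta - w] remains. *)
have small s (r1 r2 c1 c2 : R) : `|c1| <= 1 -> `|c2| <= 1 ->
    `|r1| <= M * expR (- (beta * `|s|)) -> `|r2| <= M * expR (- (beta * `|s|)) ->
    `|expR (s * y) * (c1 * r1 + c2 * r2)| <= 2 * M * expR (- ((beta - w) * `|s|)).
  move=> hc1 hc2 h1 h2; rewrite normrM ger0_norm ?expR_ge0//.
  have he : expR (s * y) <= expR (w * `|s|).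
    by rewrite ler_expR (le_trans (ler_norm _))// normrM mulrC ler_wpM2r.
  have -> : 2 * M * expR (- ((beta - w) * `|s|)) =
      expR (w * `|s|) * (M * expR (- (beta * `|s|)) + M * expR (- (beta * `|s|))).
    rewrite (_ : - ((beta - w) * `|s|) = w * `|s| + - (beta * `|s|)); last by ring.
    by rewrite expRD; ring.
  apply: ler_pM; rewrite ?expR_ge0//.
  apply: (le_trans (ler_normD _ _)); rewrite !normrM; apply: lerD.
    by apply: le_trans h1; rewrite ler_piMl.
  by apply: le_trans h2; rewrite ler_piMl.
pose W1 (s : R) := \int[mu]_x (A y x * cos (s * (x - x0)) - B y x * sin (s * (x - x0))).
pose W2 (s : R) := \int[mu]_x (B y x * cos (s * (x - x0)) - (- A y x) * sin (s * (x - x0))).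
have cNA : continuous (fun x => - A y x) by move=> x; apply: cvgN; exact: continuousA.
have bA x : `|A y x| <= K * decay x by have [] := HK y x hy.
have bB x : `|B y x| <= K * decay x by have [] := HK y x hy.
have bNA x : `|- A y x| <= K * decay x by rewrite normrN.
have b1 s : `|W1 s| <= 2 * M * expR (- ((beta - w) * `|s|)).
  by have [h1 h2] := HM s y hy; rewrite /W1 wave_re//; apply: small; rewrite ?cos_max ?sin_max.
have b2 s : `|W2 s| <= 2 * M * expR (- ((beta - w) * `|s|)).
  have [h1 h2] := HM s y hy; rewrite /W2 wave_im// -mulNr.
  by apply: small; rewrite ?normrN ?cos_max ?sin_max.
have inv1 := abel_inversion (continuousA hy) (continuousB hy) bA bB dl0 b1.
have inv2 := abel_inversion (continuousB hy) cNA bB bNA dl0 b2.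
have IE : Rintegrable (fun s : R => 2 * M * expR (- ((beta - w) * `|s|))).
  exact/RintegrableZl/Rintegrable_expRNabs.
have I1 : Rintegrable W1.
  apply: (Rintegrable_le _ IE b1).
  exact: (measurable_wave_integral x0 (continuousA hy) (continuousB hy) bA bB).
have I2 : Rintegrable W2.
  apply: (Rintegrable_le _ IE b2).
  exact: (measurable_wave_integral x0 (continuousB hy) cNA bB bNA).
have P0 := @poisson_mass_gt0 R.
have E s : g s * cexp (- ('i * (rC s * Complex x0 y))) = Complex (kappa * W1 s) (kappa * W2 s).
  rewrite /W1 /W2 wave_re// wave_im// /g /gr /gi.
  have [-> ->] := shift_UV s n0 hy.
  rewrite fourier_exponent /cexp /= cosN sinN; apply/eqP; rewrite eq_complex /=.
  by apply/andP; split; apply/eqP; ring.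
have -> : fourier g (Complex x0 y) =
    Complex (\int[mu]_s (kappa * W1 s)) (\int[mu]_s (kappa * W2 s)).
  by rewrite /fourier /cintegral; congr Complex; apply: eq_Rintegral => s _; rewrite E.
rewrite !RintegralZl// inv1 inv2 /kappa !mulKf ?gt_eqF// /A /B.
by case: (psi _).
Qed.

Lemma holomorphic_decay_inW (v : R -> R) : strongly_admissible v -> inW v w psi.
Proof.
move=> sv; apply/(inWP _ sv); exists g; last exact: fourier_g.
split=> //.
have [[mv v1 [c vD]] _] := sv.
(* Half of the margin pays for [v]; the remaining half, squared, gives the majorant
   [exp(-(beta - w)|s|)]. *)
have dl0 : 0 < (beta - w) / 2 by rewrite divr_gt0// subr_gt0.
have [Bv Bv0 HB] := admissible_subexponential mv v1 vD dl0.
have [M M0 HM] := g_small.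
have IE : Rintegrable (fun s : R => (Bv * M) ^+ 2 * expR (- ((beta - w) * `|s|))).
  by apply/RintegrableZl/Rintegrable_expRNabs; rewrite subr_gt0.
apply: (Rintegrable_le _ IE) => [|s].
  by apply: measurable_funX; exact: (measurable_wt w sv).
rewrite ger0_norm ?sqr_ge0//.
have h1 : v s * expR (w * `|s|) * cabs (g s) <=
    (Bv * M) * expR (- ((beta - w) / 2 * `|s|)).
  have v0 : 0 <= v s by rewrite (le_trans _ (v1 s)).
  apply: (@le_trans _ _ ((Bv * expR ((beta - w) / 2 * `|s|)) * expR (w * `|s|) *
      (M * expR (- (beta * `|s|))))).
    apply: ler_pM => //; first by rewrite mulr_ge0 ?expR_ge0.
      exact: cabs_ge0.
    by rewrite ler_wpM2r ?expR_ge0.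
  rewrite (_ : - ((beta - w) / 2 * `|s|) =
    (beta - w) / 2 * `|s| + w * `|s| + - (beta * `|s|)); last by field.
  by rewrite !expRD le_eqVlt; apply/orP; left; apply/eqP; ring.
rewrite (_ : - ((beta - w) * `|s|) =
  - ((beta - w) / 2 * `|s|) + - ((beta - w) / 2 * `|s|)); last by field.
rewrite expRD -expr2 -exprMn ler_pXn2r// ?nnegrE.
  by rewrite !mulr_ge0 ?expR_ge0 ?cabs_ge0// (le_trans _ (v1 s)).
by rewrite !mulr_ge0 ?expR_ge0// ltW.
Qed.

End HolomorphicDecay.

Lemma gauss_inH0 (R : realType) (th : R) : 0 < th -> inH0 th (@gauss R).
Proof.
move=> th0; split=> [z _|a a0]; first exact: derivable_gauss.
(* The modulus is [exp(y^2 - x^2)], with [y^2 <= th^2], and [a ln(1 + |x|) <= a|x| <= x^2 + a^2]. *)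
exists (expR (th ^+ 2 + a ^+ 2)) => z; rewrite /strip ifN ?gt_eqF//= => hz.
rewrite cabs_cexp; case: z hz => x y /= hy.
have n1 : 0 < 1 + `|x| by rewrite ltr_wpDr.
rewrite /powR gt_eqF// -expRD ler_expR.
have hln : ln (1 + `|x|) <= `|x|.
  by rewrite -[leRHS]expRK ler_ln ?posrE ?expR_gt0// expR_ge1Dx.
have h1 : a * ln (1 + `|x|) <= a * `|x| by rewrite ler_wpM2l// ltW.
have h2 : y ^+ 2 <= th ^+ 2.
  by rewrite -(real_normK (num_real y)) ler_pXn2r ?nnegrE ?(ltW hy) ?(ltW th0).
have h3 := sqr_ge0 (`|x| - a).
have h4 : `|x| ^+ 2 = x ^+ 2 by rewrite real_normK ?num_real.
have h5 := normr_ge0 x.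
rewrite expr2 /= opprB mulNr.
move: h1 h2 h3 h4 h5; set L := a * ln _; set X := `|x| => h1 h2 h3 h4 h5.
nra.
Qed.

(** * Algebraic rules of the calculus *)

Section PsiAlgebra.
Context {R : realType} {X : completeNormedModType R[i]}.
Variables (v : R -> R) (w : R) (D : set X) (A : X -> X) (Psi : (R[i] -> R[i]) -> X -> X).
Hypotheses (w0 : 0 <= w) (sv : strongly_admissible v) (HPsi : Wcalculus v w D A Psi).
Implicit Types (F G : R[i] -> R[i]).

Lemma calculus_bounded F : inW v w F -> bounded_op (Psi F).
Proof. by case: HPsi => [[H _ _ _ _] _]; exact: H. Qed.

Lemma calculusM F G x : inW v w F -> inW v w G -> Psi (fun z => F z * G z) x = Psi F (Psi G x).
Proof. by case: HPsi => [[_ _ _ H _] _] hF hG; rewrite H. Qed.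

Lemma calculusB F G x : inW v w F -> inW v w G ->
  Psi (fun z => F z - G z) x = Psi F x - Psi G x.
Proof.
case: HPsi => [[_ HD HZ _ _] _] hF hG.
rewrite (_ : (fun z => _) = (fun z => F z + (-1) * G z)); last first.
  by apply/funext => z; rewrite mulN1r.
by rewrite HD//; [rewrite HZ// scaleN1r|exact: inWZ].
Qed.

Lemma calculus_norm : exists M : R, forall F x, inW v w F ->
  rnorm (Psi F x) <= M * fine (Wnorm v w F) * rnorm x.
Proof.
case: HPsi => [[_ _ _ _ [M HM]] _]; exists M => F x hF.
by have := HM F hF x; rewrite !normr_rnorm -rC_mul lerC.
Qed.

Lemma gauss_inW : inW v w (@gauss R).
Proof.
(* Any larger half-width serves; this one is positive even for [w = 0]. *)
have w1 : w < w + 1 by rewrite ltrDl.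
apply: (holomorphic_decay_inW w0 w1) => //; apply: gauss_inH0.
exact: le_lt_trans w1.
Qed.

Lemma inHor_inW (f : R[i] -> R[i]) : inHor v w f -> inW v w (fun z => gauss z * f z).
Proof.
move=> [c /(_ 0) Hc].
have [g [mg ng Fg]] := Wnorm_inW (le_lt_trans Hc (ltry _)).
exists g; split=> // z sz; rewrite -Fg//.
by rewrite (_ : rC 0 = 0)// subr0.
Qed.

(* On the range of [Psi psi] the difference [f_n(A) - f(A)] is the bounded
   operator [Psi (psi * (f_n - f))]; products need not be known to lie in W, so
   differences are formed before multiplying. *)
Lemma calculus_range_diff (f h psi : R[i] -> R[i]) x y : inHor v w f -> inHor v w h ->
  inW v w psi -> inW v w (fun z => psi z * (h z - f z)) ->
  fcalc Psi h (Psi psi x) y ->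
  Psi gauss y - Psi (fun z => gauss z * f z) (Psi psi x) =
  Psi gauss (Psi (fun z => psi z * (h z - f z)) x).
Proof.
move=> /inHor_inW Wf /inHor_inW Wh Wp Wq ->.
rewrite -calculusB// -calculusM//; last exact: inWB.
rewrite -calculusM//; last exact: gauss_inW.
by congr (Psi _ x); apply/funext => z; ring.
Qed.

End PsiAlgebra.

(** * Strong convergence and identification of the limit *)

Unset Implicit Arguments.

Theorem theorem7p6 (R : realType) (X : completeNormedModType R[i])
    (w : R) (v : R -> R) (D : set X) (A : X -> X)
    (Psi : (R[i] -> R[i]) -> X -> X)
    (f : R[i] -> R[i]) (fs : nat -> R[i] -> R[i]) :
  0 <= w ->
  strongly_admissible v ->
  is_operator D A ->
  Wcalculus v w D A Psi ->
  inHor v w f ->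
  (forall n, inHor v w (fs n)) ->
  (exists Dset : set (R[i] -> R[i]),
     [/\ Dset `<=` inH0closed w, ample Psi Dset &
         forall psi, Dset psi ->
           (fun n => Wnorm v w (fun z => psi z * (fs n z - f z)))
             @ \oo --> 0%E]) ->
  (exists (T : nat -> X -> X) (M : R),
     forall n, fcalc_is Psi (fs n) (T n) /\
               forall x, `|T n x| <= rC M * `|x|) ->
  exists Tf : X -> X,
    fcalc_is Psi f Tf /\
    forall (x : X) (y : nat -> X),
      (forall n, fcalc Psi (fs n) x (y n)) -> y @ \oo --> Tf x.
Proof.
move=> w0 sv _ HPsi Hf Hfs [Dset [DH Damp Dcvg]] [T [M HT]].
have bT n : bounded_op (T n) by have [[]] := HT n.
have TM n x : rnorm (T n x) <= M * rnorm x.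
  by have [_ /(_ x)] := HT n; rewrite !normr_rnorm -rC_mul lerC.
have fT n x : fcalc Psi (fs n) x (T n x) by have [[_ /(_ x (T n x))[_ H]] _] := HT n; exact: H.
have bB := calculus_bounded HPsi (gauss_inW w0 sv).
have bS := calculus_bounded HPsi (inHor_inW Hf).
(* If [Psi gauss x = 0], the pair [(0, x)] lies in the graph of [f_0(A)], which is the graph of the
   linear map [T 0]; hence [x = 0]. *)
have injB x : Psi gauss x = 0 -> x = 0.
  move=> Bx; have [[_ /(_ 0 x)[H _]] _] := HT 0%N.
  rewrite H ?(bounded_op0 (bT 0%N))// /fcalc Bx.
  by rewrite (bounded_op0 (calculus_bounded HPsi (inHor_inW (Hfs 0%N)))).
have [Mc HMc] := calculus_norm HPsi.
pose G := [set x | exists psi y, Dset psi /\ x = Psi psi y].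
have [||C bC HC] := strong_limit bT TM bB injB bS (G := G).
- move=> _ [psi [y [Dp ->]]].
  have [th [wth Hp]] := DH _ Dp.
  have Wp : inW v w psi by exact: holomorphic_decay_inW wth Hp _ sv.
  pose q n := fun z => psi z * (fs n z - f z).
  (* Convergence to 0 makes the norms finite from some [N] on; as [Wnorm] is infinite outside W,
     this is what puts [q n] into W. *)
  have /fine_cvgP[[N _ HN] Hq] := Dcvg _ Dp.
  have Wq n : (N <= n)%N -> inW v w (q n).
    by move=> /HN; rewrite /= fin_numElt => /andP[_]; exact: Wnorm_inW.
  have E n (Nn : (N <= n)%N) := calculus_range_diff w0 sv HPsi Hf (Hfs n) Wp (Wq n Nn)
    (fT n (Psi psi y)).
  (* The candidate for [f(A)] at [Psi psi y]: the value of [f_N(A)] corrected by the difference at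
     index [N]. *)
  exists (T N (Psi psi y) - Psi (q N) y); last first.
    rewrite (bounded_opB bB) -(E N (leqnn N)) opprB addrC.
    by rewrite subrK.
  (* Injectivity of [Psi gauss] shows that the candidate does not depend on [N], so the distance to
     the limit is exactly [Psi (q n) y]. *)
  have diff n : (N <= n)%N ->
      T n (Psi psi y) - (T N (Psi psi y) - Psi (q N) y) = Psi (q n) y.
    move=> Nn; apply/eqP; rewrite -subr_eq0; apply/eqP/injB.
    rewrite !(bounded_opB bB) -(E N (leqnn N)) -(E n Nn).
    set a := Psi gauss (T n _); set b := Psi gauss (T N _); set c := Psi _ (Psi psi y).
    by rewrite subKr subrr.
  move=> e e0.
  have K0 : 0 < (`|Mc| + 1) * (rnorm y + 1).
    by rewrite mulr_gt0 ?ltr_wpDl ?rnorm_ge0.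
  have /cvgrPdist_le/(_ _ (divr_gt0 e0 K0))[N' _ HN'] := Hq.
  exists (maxn N N') => n; rewrite geq_max => /andP[Nn N'n]; rewrite diff//.
  apply: (le_trans (HMc _ _ (Wq n Nn))).
  have := HN' n N'n; rewrite /= sub0r normrN => hW.
  apply: (@le_trans _ _ ((`|Mc| + 1) * `|fine (Wnorm v w (q n))| * (rnorm y + 1))).
    apply: (@le_trans _ _ (`|Mc| * `|fine (Wnorm v w (q n))| * rnorm y)).
      by rewrite ler_wpM2r ?rnorm_ge0// -normrM ler_norm.
    apply: ler_pM; rewrite ?mulr_ge0 ?rnorm_ge0// ?lerDl//.
    by rewrite ler_wpM2r// lerDl.
  by rewrite mulrAC mulrC -ler_pdivlMr.
- apply/seteqP; split=> // x _.
  have : closure [set x | exists (n : nat) (a : 'I_n -> R[i]) (ps : 'I_n -> R[i] -> R[i])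
      (ys : 'I_n -> X), (forall i, Dset (ps i)) /\
      x = \sum_(i < n) a i *: Psi (ps i) (ys i)] x by rewrite Damp.
  apply: closure_subset => _ [n [a [ps [ys [Dps ->]]]]].
  exists n, a, (fun i => Psi (ps i) (ys i)); split=> // i.
  by exists (ps i), (ys i).
(* As [Psi gauss (C x)] equals [Psi (gauss f) x], injectivity makes [C x] the only value of [f(A)]
   at [x]. *)
exists C; split.
  split=> // x y; rewrite /fcalc -(HC x).2; split=> [Bxy|->//].
  by apply/eqP; rewrite -subr_eq0; apply/eqP/injB; rewrite (bounded_opB bB) Bxy subrr.
move=> x y Hy; apply/rcvgP.
rewrite (_ : y = T^~ x); first by have [] := HC x.
by apply/funext => n; have [[_ /(_ x (y n))[H _]] _] := HT n; exact: H.
Qed.
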